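(* There exists a one-parameter family of properly immersed translating solitons in $\mathbb{H}^2\times\mathbb{R}$, each of which has the topology of an annulus, such that along each of its two ends the height function tends to $+\infty$ (each end points in the $\partial_z$ direction), and each end is a vertical graph outside a compact set.
   Context: $\mathbb{H}^2\times\mathbb{R}$ carries the product metric $\langle\cdot,\cdot\rangle$ of the hyperbolic plane of curvature $-1$ and the real line; $\partial_z$ is the unit vertical vector field and the height function is the projection onto $\mathbb{R}$. An oriented immersed surface $M$ with unit normal $\eta$ and mean curvature $H_M$ (half the trace of the second fundamental form with respect to $\eta$) is a translating soliton if $H_M=\langle\eta,\partial_z\rangle$ at every point. *)

(* Defs.v *)
(* H^2 x R is modelled concretely as the
   upper half-space {(x,y,z) : y > 0} of R^3 with the Riemannian metric
   (dx^2 + dy^2)/y^2 + dz^2 (upper half-plane model of H^2, curvature -1,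
   times the real line).  The height function is the z-coordinate. *)
From Stdlib Require Import Reals Lra ZArith.
From Coquelicot Require Import Coquelicot.
Open Scope R_scope.

Definition vec := (R * R * R)%type.
Definition vx (u : vec) : R := fst (fst u).
Definition vy (u : vec) : R := snd (fst u).
Definition vz (u : vec) : R := snd u.
Definition vadd (u v : vec) : vec := (vx u + vx v, vy u + vy v, vz u + vz v).

Definition inH2R (p : vec) : Prop := 0 < vy p.

Definition gm (p : vec) (u v : vec) : R :=
  (vx u * vx v + vy u * vy v) / (vy p ^ 2) + vz u * vz v.

(* Levi-Civita correction term: (nabla_u V)^k = du V^k + Gamma^k_ab u^a V^b,
   with Gamma^x_xy = Gamma^x_yx = -1/y, Gamma^y_xx = 1/y, Gamma^y_yy = -1/y,
   all others 0 *)
Definition christ (p : vec) (u v : vec) : vec :=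
  (- (vx u * vy v + vy u * vx v) / vy p,
   (vx u * vx v - vy u * vy v) / vy p,
   0).

Definition d1 (f : R -> R -> R) : R -> R -> R :=
  fun th t => Derive (fun s => f s t) th.
Definition d2 (f : R -> R -> R) : R -> R -> R :=
  fun th t => Derive (fun s => f th s) t.

Definition cont2 (f : R -> R -> R) : Prop :=
  forall th t eps, 0 < eps -> exists del, 0 < del /\
    forall th' t', Rabs (th' - th) < del -> Rabs (t' - t) < del ->
      Rabs (f th' t' - f th t) < eps.

Definition partials_exist (f : R -> R -> R) : Prop :=
  forall th t, ex_derive (fun s => f s t) th /\ ex_derive (fun s => f th s) t.

Definition C2 (f : R -> R -> R) : Prop :=
  partials_exist f /\ partials_exist (d1 f) /\ partials_exist (d2 f) /\
  cont2 f /\ cont2 (d1 f) /\ cont2 (d2 f) /\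
  cont2 (d1 (d1 f)) /\ cont2 (d2 (d1 f)) /\
  cont2 (d1 (d2 f)) /\ cont2 (d2 (d2 f)).

Definition surf := R -> R -> vec.

Definition comp (F : surf) (k : nat) : R -> R -> R :=
  fun th t => match k with
              | O => vx (F th t) | 1%nat => vy (F th t) | _ => vz (F th t) end.

Definition mkv (a b c : R) : vec := (a, b, c).

Definition F1 (F : surf) th t : vec :=
  mkv (d1 (comp F 0) th t) (d1 (comp F 1) th t) (d1 (comp F 2) th t).
Definition F2 (F : surf) th t : vec :=
  mkv (d2 (comp F 0) th t) (d2 (comp F 1) th t) (d2 (comp F 2) th t).
Definition F11 (F : surf) th t : vec :=
  mkv (d1 (d1 (comp F 0)) th t) (d1 (d1 (comp F 1)) th t) (d1 (d1 (comp F 2)) th t).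
Definition F12 (F : surf) th t : vec :=
  mkv (d2 (d1 (comp F 0)) th t) (d2 (d1 (comp F 1)) th t) (d2 (d1 (comp F 2)) th t).
Definition F22 (F : surf) th t : vec :=
  mkv (d2 (d2 (comp F 0)) th t) (d2 (d2 (comp F 1)) th t) (d2 (d2 (comp F 2)) th t).

Definition fE (F : surf) th t := gm (F th t) (F1 F th t) (F1 F th t).
Definition fF (F : surf) th t := gm (F th t) (F1 F th t) (F2 F th t).
Definition fG (F : surf) th t := gm (F th t) (F2 F th t) (F2 F th t).

Definition fL (F : surf) (eta : surf) th t :=
  gm (F th t) (vadd (F11 F th t) (christ (F th t) (F1 F th t) (F1 F th t))) (eta th t).
Definition fM (F : surf) (eta : surf) th t :=
  gm (F th t) (vadd (F12 F th t) (christ (F th t) (F1 F th t) (F2 F th t))) (eta th t).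
Definition fN (F : surf) (eta : surf) th t :=
  gm (F th t) (vadd (F22 F th t) (christ (F th t) (F2 F th t) (F2 F th t))) (eta th t).

Definition meanH (F : surf) (eta : surf) th t :=
  (fE F th t * fN F eta th t - 2 * fF F th t * fM F eta th t
   + fG F th t * fL F eta th t)
  / (2 * (fE F th t * fG F th t - fF F th t ^ 2)).

(* compact subsets of H^2 x R: closed and bounded subsets of R^3 contained in
   {y > 0} (the topology of H^2 x R is the subspace topology) *)
Definition compact_H2R (K : vec -> Prop) : Prop :=
  (forall p, K p -> inH2R p) /\
  (exists B, forall p, K p -> Rabs (vx p) <= B /\ Rabs (vy p) <= B /\ Rabs (vz p) <= B) /\
  (forall p, (forall eps, 0 < eps -> exists q, K q /\
       Rabs (vx q - vx p) < eps /\ Rabs (vy q - vy p) < eps /\ Rabs (vz q - vz p) < eps)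
     -> K p).

(* An immersed annulus S^1 x R -> H^2 x R, given as a map F on R x R which is
   2*PI-periodic in theta, with a continuous unit normal eta (orientation),
   which is a properly immersed translating soliton whose two ends
   (t -> +oo, t -> -oo) have height -> +oo and are vertical graphs outside a
   compact set. *)
Definition annular_translator (F eta : surf) : Prop :=
  (forall k, C2 (comp F k)) /\
  (forall th t, inH2R (F th t)) /\
  (forall th t, F (th + 2 * PI) t = F th t) /\
  (forall th t, 0 < fE F th t * fG F th t - fF F th t ^ 2) /\
  (forall k, cont2 (comp eta k)) /\
  (forall th t, eta (th + 2 * PI) t = eta th t) /\
  (forall th t, gm (F th t) (eta th t) (F1 F th t) = 0 /\
                gm (F th t) (eta th t) (F2 F th t) = 0 /\
                gm (F th t) (eta th t) (eta th t) = 1) /\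
  (forall th t, meanH F eta th t = gm (F th t) (eta th t) (mkv 0 0 1)) /\
  (forall K, compact_H2R K -> exists T, forall th t, K (F th t) -> Rabs t <= T) /\
  (forall B, exists T, forall th t, T < t -> B < vz (F th t)) /\
  (forall B, exists T, forall th t, t < - T -> B < vz (F th t)) /\
  (exists T,
     (forall th1 t1 th2 t2, T < t1 -> T < t2 ->
        vx (F th1 t1) = vx (F th2 t2) -> vy (F th1 t1) = vy (F th2 t2) ->
        t1 = t2 /\ exists k : Z, th2 = th1 + 2 * PI * IZR k) /\
     (forall th t, T < t -> vz (eta th t) <> 0)) /\
  (exists T,
     (forall th1 t1 th2 t2, t1 < - T -> t2 < - T ->
        vx (F th1 t1) = vx (F th2 t2) -> vy (F th1 t1) = vy (F th2 t2) ->
        t1 = t2 /\ exists k : Z, th2 = th1 + 2 * PI * IZR k) /\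
     (forall th t, t < - T -> vz (eta th t) <> 0)).

Definition acosh (u : R) : R := ln (u + sqrt (u * u - 1)).
Definition distH2 (p q : vec) : R :=
  acosh (1 + ((vx p - vx q) ^ 2 + (vy p - vy q) ^ 2) / (2 * vy p * vy q)).
Definition dist (p q : vec) : R :=
  sqrt (distH2 p q ^ 2 + (vz p - vz q) ^ 2).

Definition isometry (Phi : vec -> vec) : Prop :=
  (forall p, inH2R p -> inH2R (Phi p)) /\
  (forall q, inH2R q -> exists p, inH2R p /\ Phi p = q) /\
  (forall p q, inH2R p -> inH2R q -> dist (Phi p) (Phi q) = dist p q).

Definition congruent (F G : surf) : Prop :=
  exists Phi, isometry Phi /\
    forall p, (exists th t, Phi (F th t) = p) <-> (exists th t, G th t = p).

(* Main.v *)
(** The surfaces are rotational, with profile curve [(r, z)] parametrized by arc length and tangent angle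
[phi]; the soliton equation becomes [r' = cos phi], [z' = sin phi],
[phi' = 2 cos phi - coth r sin phi].  Start vertically at distance [l] from the axis.  Since
[(cos phi e^(2z))' = coth r sin^2 phi e^(2z) >= 0], the radius increases away from the neck in both
directions, so [r >= l] and the solution is global; the slope [w = tan phi] satisfies
[w' = (2 - w coth r) / cos phi], which traps it between two positive constants, so both wings rise
linearly.  The neck radius is an isometry invariant: vertical segments are characterized metrically by
Apollonius' identity for medians (compare with points tending to the boundary of the half-plane), so an
isometry permutes the vertical fibres, and the fibres that miss the surface form an open disc of
radius [l]. *)

From Stdlib Require Import Reals Lra Lia Nsatz Classical ClassicalEpsilon FunctionalExtensionality.
From Coquelicot Require Import Coquelicot.
Require Import Defs.
Open Scope R_scope.

(** * A global Cauchy-Lipschitz theorem in the plane *)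

(** The factor [coth r] is singular on the axis, so the profile equation is not globally Lipschitz.
    Instead of continuing local solutions, the equation is solved with [coth] cut off below the neck
    radius. The sign argument for [cos phi] only needs a coefficient that is at least 1, so it
    applies to the truncated equation, and it shows afterwards that the cut is never reached. The
    right-hand side of the angle equation changes sign under [phi -> phi + PI], exactly as a time
    derivative does under reversal; hence both wings obey the same system, and the analysis of one
    end serves for both. Congruence is tested against surjections that merely preserve distances,
    with no differentiability assumed, so the vertical direction has to be recovered from the
    metric. In negative curvature the identity for medians cannot hold against all points of the
    space unless the side is vertical. The radius of the disc of missed fibres is then read off from
    its diameter. *)

Lemma derive_nonneg_le (f df : R -> R) (a b : R) :
  a <= b -> (forall t, a <= t <= b -> is_derive f t (df t)) ->
  (forall t, a <= t <= b -> 0 <= df t) -> f a <= f b.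
Proof.
  intros Hab Hd Hp.
  destruct (MVT_gen f a b df) as [c [Hc E]].
  - intros x Hx. rewrite Rmin_left, Rmax_right in Hx by lra. apply Hd; lra.
  - intros x Hx. rewrite Rmin_left, Rmax_right in Hx by lra.
    apply continuity_pt_filterlim, (ex_derive_continuous f x).
    exists (df x). apply Hd; lra.
  - rewrite Rmin_left, Rmax_right in Hc by lra.
    pose proof (Hp c Hc). nra.
Qed.

(** Integrating [exp (k |s|)] from 0 costs at most a factor [1 / k]. This gain is what makes the
    Picard operator contract on the whole line at once. *)
Lemma growth_exp (X dX : R -> R) (A k : R) :
  0 < k -> X 0 = 0 -> (forall t, is_derive X t (dX t)) ->
  (forall t, Rabs (dX t) <= A * exp (k * Rabs t)) ->
  forall t, Rabs (X t) <= A / k * exp (k * Rabs t).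
Proof.
  intros Hk X0 HX HdX t.
  assert (HA : 0 <= A).
  { pose proof (HdX 0) as H. rewrite Rabs_R0, Rmult_0_r, exp_0 in H.
    pose proof (Rabs_pos (dX 0)). lra. }
  assert (HAk : 0 <= A / k) by (apply Rmult_le_pos; [lra | left; now apply Rinv_0_lt_compat]).
  (* Both [e] and [c] are signs: [e] reflects time so that the comparison runs over [[0, |t|]], and
     [c] selects the upper or the lower bound on [X t]. *)
  assert (bound : forall (e c : R), (forall s, Rabs s = e * s -> Rabs s <= Rabs t ->
            e * c * dX s <= A * exp (k * (e * s))) -> e * e = 1 -> Rabs t = e * t ->
            c * X t <= A / k * exp (k * Rabs t)).
  { intros e c He Hee Het. rewrite Het.
    pose (G := fun s => A / k * exp (k * s) - c * X (e * s)).
    assert (HG : G 0 <= G (e * t)).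
    { apply (derive_nonneg_le G (fun s => A * exp (k * s) - e * c * dX (e * s))).
      - rewrite <- Het; apply Rabs_pos.
      - intros s _. unfold G. auto_derive.
        + exists (dX (e * s)). apply HX.
        + replace (Derive _ (e * s)) with (dX (e * s)) by (symmetry; apply (is_derive_unique X), HX).
          field; lra.
      - intros s Hs.
        assert (Hes : Rabs (e * s) = e * (e * s)).
        { rewrite <- Rmult_assoc, Hee, Rmult_1_l, Rabs_mult.
          assert (e = 1 \/ e = -1) as [-> | ->] by (destruct (Rle_dec 0 e); [left|right]; nra).
          - rewrite Rabs_R1, Rabs_pos_eq; lra.
          - rewrite Rabs_left, (Rabs_pos_eq s); lra. }
        pose proof (He (e * s) Hes) as H.
        replace (e * (e * s)) with s in * by (rewrite <- Rmult_assoc, Hee; ring).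
        rewrite Hes in H. specialize (H ltac:(lra)). lra. }
    unfold G in HG. rewrite !Rmult_0_r, X0, exp_0 in HG.
    replace (e * (e * t)) with t in HG by (rewrite <- Rmult_assoc, Hee; ring). lra. }
  assert (abs_bound : forall s u, Rabs u = 1 -> u * dX s <= A * exp (k * Rabs s)).
  { intros s u Hu. apply Rle_trans with (Rabs (u * dX s)); [apply Rle_abs|].
    rewrite Rabs_mult, Hu, Rmult_1_l. apply HdX. }
  assert (both : forall c, Rabs c = 1 -> c * X t <= A / k * exp (k * Rabs t)).
  { intros c Hc. destruct (Rle_dec 0 t).
    - apply (bound 1 c); [|ring|rewrite Rabs_pos_eq; lra].
      intros s Hs _. rewrite <- Hs. apply abs_bound. rewrite Rmult_1_l; exact Hc.
    - apply (bound (-1) c); [|ring|rewrite Rabs_left; lra].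
      intros s Hs _. rewrite <- Hs. apply abs_bound.
      rewrite Rabs_mult, Hc, Rabs_left; lra. }
  apply Rabs_le. pose proof (both 1 Rabs_R1).
  pose proof (both (-1) ltac:(rewrite Rabs_left; lra)). lra.
Qed.

Lemma half_pow_lim (C : R) : is_lim_seq (fun n => C * (1 / 2) ^ n) 0.
Proof.
  replace (Finite 0) with (Rbar_mult C 0) by (simpl; f_equal; ring).
  apply is_lim_seq_scal_l, is_lim_seq_geom. rewrite Rabs_pos_eq; lra.
Qed.

Lemma le_of_half_pow (a b C : R) :
  (forall n, a <= b + C * (1 / 2) ^ n) -> a <= b.
Proof.
  intros H.
  assert (Hl : is_lim_seq (fun n => b + C * (1 / 2) ^ n) b).
  { replace (Finite b) with (Finite (b + 0)) by (f_equal; ring).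
    apply is_lim_seq_plus'; [apply is_lim_seq_const | apply half_pow_lim]. }
  exact (is_lim_seq_le _ _ _ _ H (is_lim_seq_const a) Hl).
Qed.

(** The explicit rate lets estimates pass to the limit through [le_of_half_pow], so no limit has to
    be exchanged with an integral. *)
Lemma geometric_limit (u : nat -> R) (C : R) :
  (forall n, Rabs (u (S n) - u n) <= C * (1 / 2) ^ n) ->
  forall n, Rabs (real (Lim_seq u) - u n) <= 2 * C * (1 / 2) ^ n.
Proof.
  intros H.
  assert (HC : 0 <= C).
  { pose proof (H O) as H0. simpl in H0. pose proof (Rabs_pos (u 1%nat - u O)). lra. }
  assert (tail : forall n k, Rabs (u (n + k)%nat - u n)
                    <= 2 * C * (1 / 2) ^ n - 2 * C * (1 / 2) ^ (n + k)).
  { intros n k. induction k as [|k IH].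
    - rewrite Nat.add_0_r. unfold Rminus. rewrite !Rplus_opp_r, Rabs_R0. lra.
    - rewrite Nat.add_succ_r.
      replace (u (S (n + k)) - u n)
        with ((u (S (n + k)) - u (n + k)%nat) + (u (n + k)%nat - u n)) by ring.
      eapply Rle_trans; [apply Rabs_triang|]. pose proof (H (n + k)%nat). simpl. lra. }
  assert (half_pos : forall n, 0 < (1 / 2) ^ n) by (intros n; apply pow_lt; lra).
  assert (tail' : forall n m, (n <= m)%nat -> Rabs (u m - u n) <= 2 * C * (1 / 2) ^ n).
  { intros n m Hm. pose proof (tail n (m - n)%nat) as Ht.
    replace (n + (m - n))%nat with m in Ht by lia.
    pose proof (half_pos m). nra. }
  assert (Hex : ex_finite_lim_seq u).
  { apply ex_lim_seq_cauchy_corr. intros eps.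
    destruct (proj1 (is_lim_seq_Reals _ _) (half_pow_lim (2 * C)) (eps / 2)) as [N HN].
    { destruct eps; simpl; lra. }
    assert (HN' : 2 * C * (1 / 2) ^ N < eps / 2).
    { specialize (HN N (le_n N)). unfold Rdist in HN. rewrite Rminus_0_r in HN.
      apply Rle_lt_trans with (2 := HN). apply Rle_abs. }
    exists N. intros n m Hn Hm.
    replace (u n - u m) with ((u n - u N) - (u m - u N)) by ring.
    pose proof (tail' N n Hn). pose proof (tail' N m Hm).
    pose proof (Rabs_triang (u n - u N) (- (u m - u N))) as Ht.
    rewrite Rabs_Ropp in Ht. unfold Rminus at 1. lra. }
  intros n.
  pose proof (Lim_seq_correct' u Hex) as HL.
  assert (HL' : is_lim_seq (fun m => Rabs (u (m + n)%nat - u n)) (Rabs (real (Lim_seq u) - u n))).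
  { apply (is_lim_seq_abs _ (Finite (real (Lim_seq u) - u n))).
    apply is_lim_seq_minus'; [|apply is_lim_seq_const].
    now apply (is_lim_seq_incr_n u n). }
  refine (is_lim_seq_le _ _ (Finite _) (Finite _) _ HL' (is_lim_seq_const _)).
  intros m. apply tail'. lia.
Qed.

Definition lipschitz (B : R) (x : R -> R) : Prop :=
  forall s t, Rabs (x s - x t) <= B * Rabs (s - t).

Lemma lipschitz_continuous (B : R) (x : R -> R) :
  lipschitz B x -> forall t, continuous x t.
Proof.
  intros H t. apply continuity_pt_filterlim. intros eps He.
  exists (eps / (Rabs B + 1)). pose proof (Rabs_pos B). split.
  { apply Rdiv_lt_0_compat; lra. }
  intros s [_ Hs]. simpl in *. unfold Rdist in *.
  apply Rle_lt_trans with (1 := H s t).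
  apply Rle_lt_trans with (Rabs B * Rabs (s - t)).
  { apply Rmult_le_compat_r; [apply Rabs_pos | apply Rle_abs]. }
  apply (Rmult_lt_compat_l (Rabs B + 1)) in Hs; [|lra].
  replace ((Rabs B + 1) * (eps / (Rabs B + 1))) with eps in Hs by (field; lra).
  pose proof (Rabs_pos (s - t)). lra.
Qed.

Lemma derive_bounded_lipschitz (x dx : R -> R) (B : R) :
  (forall t, is_derive x t (dx t)) -> (forall t, Rabs (dx t) <= B) -> lipschitz B x.
Proof.
  intros Hd Hb s t.
  destruct (MVT_gen x t s dx) as [c [_ E]].
  - intros u _; apply Hd.
  - intros u _. apply continuity_pt_filterlim, (ex_derive_continuous x u).
    exists (dx u); apply Hd.
  - rewrite E, Rabs_mult. apply Rmult_le_compat_r; [apply Rabs_pos | apply Hb].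
Qed.

Lemma is_derive_primitive (h : R -> R) (x0 : R) :
  (forall t, continuous h t) ->
  forall t, is_derive (fun t => x0 + RInt h 0 t) t (h t).
Proof.
  intros Hc t. apply (is_derive_ext (fun t => plus x0 (RInt h 0 t))); [reflexivity|].
  replace (h t) with (plus zero (h t)) by apply plus_zero_l.
  apply (is_derive_plus (fun _ => x0)).
  - apply @is_derive_const.
  - apply (is_derive_RInt h (RInt h 0) 0 t); [|apply Hc].
    apply filter_forall. intros u. apply (RInt_correct h 0 u), (ex_RInt_continuous h).
    intros v _; apply Hc.
Qed.

Section CauchyLipschitz.

Context (f g : R -> R -> R) (B K x0 y0 : R).
Context (HK : 0 < K).
Context (Hf : forall x y, Rabs (f x y) <= B).
Context (Hg : forall x y, Rabs (g x y) <= B).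
Context (HfL : forall x y x' y',
  Rabs (f x y - f x' y') <= K * (Rabs (x - x') + Rabs (y - y'))).
Context (HgL : forall x y x' y',
  Rabs (g x y - g x' y') <= K * (Rabs (x - x') + Rabs (y - y'))).

Definition picard_step (P : (R -> R) * (R -> R)) : (R -> R) * (R -> R) :=
  (fun t => x0 + RInt (fun s => f (fst P s) (snd P s)) 0 t,
   fun t => y0 + RInt (fun s => g (fst P s) (snd P s)) 0 t).

Fixpoint picard (n : nat) : (R -> R) * (R -> R) :=
  match n with
  | O => (fun _ => x0, fun _ => y0)
  | S n => picard_step (picard n)
  end.

Lemma lipschitz_comp2 (h : R -> R -> R) (x y : R -> R) :
  (forall x y x' y', Rabs (h x y - h x' y') <= K * (Rabs (x - x') + Rabs (y - y'))) ->
  lipschitz B x -> lipschitz B y -> forall t, continuous (fun s => h (x s) (y s)) t.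
Proof.
  intros Hh Hx Hy. apply (lipschitz_continuous (2 * K * B)). intros s t.
  apply Rle_trans with (1 := Hh _ _ _ _).
  specialize (Hx s t). specialize (Hy s t). nra.
Qed.

Lemma picard_step_derive (P : (R -> R) * (R -> R)) :
  lipschitz B (fst P) -> lipschitz B (snd P) -> forall t,
  is_derive (fst (picard_step P)) t (f (fst P t) (snd P t)) /\
  is_derive (snd (picard_step P)) t (g (fst P t) (snd P t)).
Proof.
  intros Hx Hy t. split.
  - apply (is_derive_primitive (fun s => f (fst P s) (snd P s))).
    now apply lipschitz_comp2.
  - apply (is_derive_primitive (fun s => g (fst P s) (snd P s))).
    now apply lipschitz_comp2.
Qed.

Lemma picard_step_0 (P : (R -> R) * (R -> R)) :
  fst (picard_step P) 0 = x0 /\ snd (picard_step P) 0 = y0.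
Proof. simpl. rewrite !RInt_point. unfold zero; simpl. split; ring. Qed.

Lemma picard_lipschitz (n : nat) :
  lipschitz B (fst (picard n)) /\ lipschitz B (snd (picard n)).
Proof.
  induction n as [|n [Hx Hy]].
  - assert (0 <= B) by (apply Rle_trans with (2 := Hf 0 0); apply Rabs_pos).
    split; intros s t; simpl; unfold Rminus; rewrite Rplus_opp_r, Rabs_R0;
      apply Rmult_le_pos; trivial; apply Rabs_pos.
  - split.
    + apply (derive_bounded_lipschitz _ (fun t => f (fst (picard n) t) (snd (picard n) t)));
        intros t; [apply (picard_step_derive _ Hx Hy t) | apply Hf].
    + apply (derive_bounded_lipschitz _ (fun t => g (fst (picard n) t) (snd (picard n) t)));
        intros t; [apply (picard_step_derive _ Hx Hy t) | apply Hg].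
Qed.

(* In the norm weighted by [exp (- 4 K |t|)] the Picard operator is a contraction with factor 1/2. *)
Lemma picard_step_contract (P Q : (R -> R) * (R -> R)) (M : R) :
  lipschitz B (fst P) -> lipschitz B (snd P) ->
  lipschitz B (fst Q) -> lipschitz B (snd Q) ->
  (forall t, Rabs (fst P t - fst Q t) <= M * exp (4 * K * Rabs t) /\
             Rabs (snd P t - snd Q t) <= M * exp (4 * K * Rabs t)) ->
  forall t,
    Rabs (fst (picard_step P) t - fst (picard_step Q) t) <= M / 2 * exp (4 * K * Rabs t) /\
    Rabs (snd (picard_step P) t - snd (picard_step Q) t) <= M / 2 * exp (4 * K * Rabs t).
Proof.
  intros H1 H2 H3 H4 HM t.
  (* The two Lipschitz terms add up to [2 K M], and integration against the weight divides by
     [4 K]. *)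
  assert (EM : M / 2 = 2 * K * M / (4 * K)) by (field; lra).
  split; rewrite EM.
  - apply (growth_exp (fun t => fst (picard_step P) t - fst (picard_step Q) t)
             (fun t => f (fst P t) (snd P t) - f (fst Q t) (snd Q t))); [lra| | |].
    + rewrite !(proj1 (picard_step_0 _)). ring.
    + intros s. apply @is_derive_minus; now apply picard_step_derive.
    + intros s. apply Rle_trans with (1 := HfL _ _ _ _). destruct (HM s). nra.
  - apply (growth_exp (fun t => snd (picard_step P) t - snd (picard_step Q) t)
             (fun t => g (fst P t) (snd P t) - g (fst Q t) (snd Q t))); [lra| | |].
    + rewrite !(proj2 (picard_step_0 _)). ring.
    + intros s. apply @is_derive_minus; now apply picard_step_derive.
    + intros s. apply Rle_trans with (1 := HgL _ _ _ _). destruct (HM s). nra.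
Qed.

(** The first step has derivative at most [B], hence weighted size at most [B / (4 K)]; every
    further step halves the difference. *)
Lemma picard_diff (n : nat) (t : R) :
  Rabs (fst (picard (S n)) t - fst (picard n) t)
    <= B / (4 * K) * exp (4 * K * Rabs t) * (1 / 2) ^ n /\
  Rabs (snd (picard (S n)) t - snd (picard n) t)
    <= B / (4 * K) * exp (4 * K * Rabs t) * (1 / 2) ^ n.
Proof.
  revert t. induction n as [|n IH]; intros t.
  - rewrite pow_O, Rmult_1_r.
    assert (HB : forall b s, Rabs b <= B -> Rabs b <= B * exp (4 * K * Rabs s)).
    { intros b s Hb. pose proof (Rabs_pos b). pose proof (Rabs_pos s).
      pose proof (exp_ineq1_le (4 * K * Rabs s)).
      assert (0 <= 4 * K * Rabs s) by (apply Rmult_le_pos; lra).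
      apply Rle_trans with (1 := Hb). nra. }
    destruct (picard_lipschitz 0) as [Hx Hy].
    split.
    + apply (growth_exp (fun t => fst (picard 1) t - x0) (fun t => f x0 y0)); [lra| | |].
      * simpl picard. rewrite (proj1 (picard_step_0 _)). ring.
      * intros s. replace (f x0 y0) with (minus (f x0 y0) zero)
          by (unfold minus, plus, opp, zero; simpl; ring).
        apply @is_derive_minus; [apply (picard_step_derive _ Hx Hy s) | apply @is_derive_const].
      * intros s. apply HB, Hf.
    + apply (growth_exp (fun t => snd (picard 1) t - y0) (fun t => g x0 y0)); [lra| | |].
      * simpl picard. rewrite (proj2 (picard_step_0 _)). ring.
      * intros s. replace (g x0 y0) with (minus (g x0 y0) zero)
          by (unfold minus, plus, opp, zero; simpl; ring).
        apply @is_derive_minus; [apply (picard_step_derive _ Hx Hy s) | apply @is_derive_const].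
      * intros s. apply HB, Hg.
  - replace (B / (4 * K) * exp (4 * K * Rabs t) * (1 / 2) ^ S n)
      with (B / (4 * K) * (1 / 2) ^ n / 2 * exp (4 * K * Rabs t)) by (simpl; field; lra).
    destruct (picard_lipschitz n) as [Hx Hy]. destruct (picard_lipschitz (S n)) as [Hx' Hy'].
    apply (picard_step_contract (picard (S n)) (picard n)); trivial.
    intros s. specialize (IH s). split;
    replace (B / (4 * K) * (1 / 2) ^ n * exp (4 * K * Rabs s))
      with (B / (4 * K) * exp (4 * K * Rabs s) * (1 / 2) ^ n) by ring; apply IH.
Qed.

Theorem cauchy_lipschitz : exists x y : R -> R,
  x 0 = x0 /\ y 0 = y0 /\
  (forall t, is_derive x t (f (x t) (y t))) /\ (forall t, is_derive y t (g (x t) (y t))).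
Proof.
  pose (x := fun t => real (Lim_seq (fun n => fst (picard n) t))).
  pose (y := fun t => real (Lim_seq (fun n => snd (picard n) t))).
  pose (M := fun t => B / (4 * K) * exp (4 * K * Rabs t)).
  assert (Lx : forall t n, Rabs (x t - fst (picard n) t) <= 2 * M t * (1 / 2) ^ n).
  { intros t. apply (geometric_limit (fun n => fst (picard n) t)). intros n. apply picard_diff. }
  assert (Ly : forall t n, Rabs (y t - snd (picard n) t) <= 2 * M t * (1 / 2) ^ n).
  { intros t. apply (geometric_limit (fun n => snd (picard n) t)). intros n. apply picard_diff. }
  (* Pointwise convergence is enough here, since a Lipschitz inequality involves only two points at
     a time. *)
  assert (lip : forall (u : R -> R) (un : nat -> R -> R), (forall n, lipschitz B (un n)) ->
            (forall t n, Rabs (u t - un n t) <= 2 * M t * (1 / 2) ^ n) -> lipschitz B u).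
  { intros u un Hun Hu s t. apply (le_of_half_pow _ _ (2 * M s + 2 * M t)). intros n.
    pose proof (Hu s n) as Hs. pose proof (Hu t n) as Ht. specialize (Hun n s t).
    replace (u s - u t) with ((u s - un n s) + (un n s - un n t) + - (u t - un n t)) by ring.
    eapply Rle_trans; [apply Rabs_triang|]. rewrite Rabs_Ropp.
    pose proof (Rabs_triang (u s - un n s) (un n s - un n t)). lra. }
  assert (lx : lipschitz B x) by (apply (lip x (fun n => fst (picard n))); [apply picard_lipschitz | apply Lx]).
  assert (ly : lipschitz B y) by (apply (lip y (fun n => snd (picard n))); [apply picard_lipschitz | apply Ly]).
  (* The contraction, applied to the limit and the [n]-th iterate, places the Picard step of the
     limit near iterate [S n]; as that iterate also tends to the limit, the limit is a fixed
     point. *)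
  assert (close : forall t n,
     Rabs (fst (picard_step (x, y)) t - fst (picard (S n)) t) <= M t * (1 / 2) ^ n /\
     Rabs (snd (picard_step (x, y)) t - snd (picard (S n)) t) <= M t * (1 / 2) ^ n).
  { intros t n. unfold M.
    replace (B / (4 * K) * exp (4 * K * Rabs t) * (1 / 2) ^ n)
      with (2 * (B / (4 * K)) * (1 / 2) ^ n / 2 * exp (4 * K * Rabs t)) by (field; lra).
    apply (picard_step_contract (x, y) (picard n)); trivial; try apply picard_lipschitz.
    intros s. simpl.
    replace (2 * (B / (4 * K)) * (1 / 2) ^ n * exp (4 * K * Rabs s))
      with (2 * M s * (1 / 2) ^ n) by (unfold M; ring).
    split; [apply Lx | apply Ly]. }
  assert (eqlim : forall a b (u : nat -> R) C,
     (forall n, Rabs (a - u (S n)) <= C * (1 / 2) ^ n) ->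
     (forall n, Rabs (b - u n) <= 2 * C * (1 / 2) ^ n) -> a = b).
  { intros a b u C Ha Hb.
    assert (Rabs (a - b) <= 0) as H0.
    { apply (le_of_half_pow _ _ (2 * C)). intros n.
      replace (a - b) with ((a - u (S n)) + - (b - u (S n))) by ring.
      eapply Rle_trans; [apply Rabs_triang|]. rewrite Rabs_Ropp.
      pose proof (Ha n). pose proof (Hb (S n)). simpl in *. lra. }
    pose proof (Rabs_pos (a - b)).
    destruct (Req_dec (a - b) 0); [lra|]. pose proof (Rabs_pos_lt _ H1). lra. }
  assert (Ex : forall t, fst (picard_step (x, y)) t = x t).
  { intros t. apply (eqlim _ _ (fun n => fst (picard n) t) (M t)); [|apply Lx].
    intros n. apply close. }
  assert (Ey : forall t, snd (picard_step (x, y)) t = y t).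
  { intros t. apply (eqlim _ _ (fun n => snd (picard n) t) (M t)); [|apply Ly].
    intros n. apply close. }
  exists x, y. split; [|split; [|split]].
  - rewrite <- Ex. apply picard_step_0.
  - rewrite <- Ey. apply picard_step_0.
  - intros t. apply (is_derive_ext _ _ _ _ Ex), (picard_step_derive (x, y) lx ly t).
  - intros t. apply (is_derive_ext _ _ _ _ Ey), (picard_step_derive (x, y) lx ly t).
Qed.

End CauchyLipschitz.

(** * The profile curve *)

Lemma sq_sin_cos (x : R) : sin x * sin x + cos x * cos x = 1.
Proof. pose proof (sin2_cos2 x) as H. unfold Rsqr in H. lra. Qed.

Lemma sq_cosh_sinh (x : R) : cosh x * cosh x - sinh x * sinh x = 1.
Proof.
  unfold cosh, sinh. pose proof (exp_plus x (- x)) as H.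
  rewrite Rplus_opp_r, exp_0 in H. nra.
Qed.

Lemma sinh_pos (x : R) : 0 < x -> 0 < sinh x.
Proof. intros H. unfold sinh. pose proof (exp_increasing (- x) x). lra. Qed.

Lemma cosh_pos (x : R) : 0 < cosh x.
Proof. unfold cosh. pose proof (exp_pos x). pose proof (exp_pos (- x)). lra. Qed.

Lemma is_derive_cosh (x : R) : is_derive cosh x (sinh x).
Proof. apply is_derive_Reals, derivable_pt_lim_cosh. Qed.

Lemma is_derive_sinh (x : R) : is_derive sinh x (cosh x).
Proof. apply is_derive_Reals, derivable_pt_lim_sinh. Qed.

Lemma cosh_increasing (x y : R) : 0 <= x -> x < y -> cosh x < cosh y.
Proof.
  intros Hx Hxy. unfold cosh. pose proof (exp_increasing x y Hxy) as H.
  pose proof (exp_pos x). pose proof (exp_pos (- x)).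
  pose proof (exp_pos y). pose proof (exp_pos (- y)).
  pose proof (exp_plus x (- x)) as Ex. rewrite Rplus_opp_r, exp_0 in Ex.
  pose proof (exp_plus y (- y)) as Ey. rewrite Rplus_opp_r, exp_0 in Ey.
  assert (1 <= exp x) by (pose proof (exp_ineq1_le x); lra).
  (* With denominators cleared, the difference of the two sides is
     [(exp y - exp x) (exp x exp y - 1)]. *)
  apply Rmult_lt_reg_l with (2 * exp x * exp y); [nra|].
  replace (2 * exp x * exp y * ((exp x + exp (- x)) / 2))
    with (exp x * exp x * exp y + (exp x * exp (- x)) * exp y) by field.
  replace (2 * exp x * exp y * ((exp y + exp (- y)) / 2))
    with (exp x * exp y * exp y + (exp y * exp (- y)) * exp x) by field.
  rewrite <- Ex, <- Ey. assert (1 < exp x * exp y) by nra. nra.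
Qed.

Lemma sinh_increasing (x y : R) : x < y -> sinh x < sinh y.
Proof.
  intros Hxy. unfold sinh. pose proof (exp_increasing x y Hxy).
  pose proof (exp_increasing (- y) (- x)). lra.
Qed.

Definition coth (x : R) : R := cosh x / sinh x.

Lemma coth_gt_1 (x : R) : 0 < x -> 1 < coth x.
Proof.
  intros H. unfold coth. pose proof (sinh_pos x H).
  apply Rmult_lt_reg_r with (sinh x); trivial.
  replace (cosh x / sinh x * sinh x) with (cosh x) by (field; lra).
  unfold cosh, sinh. pose proof (exp_pos (- x)). lra.
Qed.

Lemma is_derive_coth (x : R) : 0 < x -> is_derive coth x (- / (sinh x * sinh x)).
Proof.
  intros H. pose proof (sinh_pos x H). unfold coth.
  replace (- / (sinh x * sinh x))
    with ((sinh x * sinh x - cosh x * cosh x) / sinh x ^ 2).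
  - apply is_derive_div; [apply is_derive_cosh | apply is_derive_sinh | lra].
  - replace (sinh x * sinh x - cosh x * cosh x) with (-1)
      by (pose proof (sq_cosh_sinh x); lra). field. lra.
Qed.

Lemma coth_lipschitz (l x y : R) : 0 < l -> l <= x -> l <= y ->
  Rabs (coth x - coth y) <= / (sinh l * sinh l) * Rabs (x - y).
Proof.
  intros Hl Hx Hy.
  assert (Hmin : forall u, Rmin y x <= u -> l <= u).
  { intros u Hu. apply Rle_trans with (2 := Hu). now apply Rmin_glb. }
  destruct (MVT_gen coth y x (fun x => - / (sinh x * sinh x))) as [c [Hc E]].
  - intros u [Hu _]. apply is_derive_coth. specialize (Hmin u). lra.
  - intros u [Hu _]. apply continuity_pt_filterlim, (ex_derive_continuous coth u).
    eexists. apply is_derive_coth. specialize (Hmin u). lra.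
  - rewrite E, Rabs_mult, Rabs_Ropp.
    apply Rmult_le_compat_r; [apply Rabs_pos|].
    pose proof (sinh_pos l Hl). pose proof (Hmin c (proj1 Hc)).
    assert (sinh l <= sinh c).
    { destruct (Req_dec l c) as [->|]; [lra|]. left; apply sinh_increasing. lra. }
    rewrite Rabs_pos_eq by (left; apply Rinv_0_lt_compat; nra).
    apply Rinv_le_contravar; nra.
Qed.

Lemma coth_decreasing (l x : R) : 0 < l -> l <= x -> coth x <= coth l.
Proof.
  intros Hl Hx.
  assert (- coth l <= - coth x); [|lra].
  apply (derive_nonneg_le (fun x => - coth x) (fun x => / (sinh x * sinh x))); trivial.
  - intros t Ht. replace (/ (sinh t * sinh t)) with (opp (- / (sinh t * sinh t)))
      by (unfold opp; simpl; ring).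
    apply @is_derive_opp, is_derive_coth. lra.
  - intros t Ht. pose proof (sinh_pos t). left. apply Rinv_0_lt_compat. nra.
Qed.

Lemma sin_lipschitz (x y : R) : Rabs (sin x - sin y) <= Rabs (x - y).
Proof.
  rewrite <- (Rmult_1_l (Rabs (x - y))).
  apply (derive_bounded_lipschitz sin cos).
  - intros t. apply is_derive_Reals, derivable_pt_lim_sin.
  - intros t. apply Rabs_le, COS_bound.
Qed.

Lemma cos_lipschitz (x y : R) : Rabs (cos x - cos y) <= Rabs (x - y).
Proof.
  rewrite <- (Rmult_1_l (Rabs (x - y))).
  apply (derive_bounded_lipschitz cos (fun t => - sin t)).
  - intros t. apply is_derive_Reals, derivable_pt_lim_cos.
  - intros t. rewrite Rabs_Ropp. apply Rabs_le, SIN_bound.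
Qed.

Lemma Rmax_lipschitz (l x y : R) : Rabs (Rmax l x - Rmax l y) <= Rabs (x - y).
Proof. unfold Rmax, Rabs. repeat destruct Rle_dec; repeat destruct Rcase_abs; lra. Qed.

(* Truncating [coth] below [l] makes the angle equation globally Lipschitz. *)
Lemma truncated_profile (l : R) : 0 < l -> exists phi r z : R -> R,
  phi 0 = PI / 2 /\ r 0 = l /\
  (forall t, is_derive phi t (2 * cos (phi t) - coth (Rmax l (r t)) * sin (phi t))) /\
  (forall t, is_derive r t (cos (phi t))) /\
  (forall t, is_derive z t (sin (phi t))).
Proof.
  (* One constant serves as bound and as Lipschitz constant: [2 + coth l] controls the size of the
     field and its dependence on the angle, [1 / sinh^2 l] the dependence on the radius. *)
  intros Hl. set (K := 2 + coth l + / (sinh l * sinh l)).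
  pose proof (coth_gt_1 l Hl) as Hc. pose proof (sinh_pos l Hl) as Hs.
  assert (Hi : 0 < / (sinh l * sinh l)) by (apply Rinv_0_lt_compat; nra).
  assert (Hb : forall x, 0 <= coth (Rmax l x) <= coth l).
  { intros x. pose proof (Rmax_l l x).
    pose proof (coth_gt_1 (Rmax l x)). pose proof (coth_decreasing l (Rmax l x) Hl). lra. }
  destruct (cauchy_lipschitz (fun p r => 2 * cos p - coth (Rmax l r) * sin p)
              (fun p r => cos p) K K (PI / 2) l) as (phi & r & H1 & H2 & H3 & H4).
  - unfold K; lra.
  - intros p r. specialize (Hb r). pose proof (COS_bound p). pose proof (SIN_bound p).
    unfold K. apply Rabs_le. nra.
  - intros p r. pose proof (COS_bound p). apply Rabs_le. unfold K. lra.
  - intros p r p' r'. pose proof (cos_lipschitz p p') as Lc. pose proof (sin_lipschitz p p') as Ls.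
    assert (Lr : Rabs (coth (Rmax l r) - coth (Rmax l r')) <= / (sinh l * sinh l) * Rabs (r - r')).
    { apply Rle_trans with (1 := coth_lipschitz l _ _ Hl (Rmax_l l r) (Rmax_l l r')).
      apply Rmult_le_compat_l; [lra | apply Rmax_lipschitz]. }
    specialize (Hb r).
    set (k := coth (Rmax l r)) in *. set (k' := coth (Rmax l r')) in *.
    replace (2 * cos p - k * sin p - (2 * cos p' - k' * sin p'))
      with (2 * (cos p - cos p') + (- (k * (sin p - sin p')) + - (sin p' * (k - k')))) by ring.
    eapply Rle_trans; [apply Rabs_triang|].
    eapply Rle_trans; [apply Rplus_le_compat_l, Rabs_triang|].
    rewrite !Rabs_Ropp, !Rabs_mult, (Rabs_pos_eq 2), (Rabs_pos_eq k) by lra.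
    assert (Rabs (sin p') <= 1) by (apply Rabs_le, SIN_bound).
    pose proof (Rabs_pos (p - p')). pose proof (Rabs_pos (r - r')).
    pose proof (Rabs_pos (sin p')). pose proof (Rabs_pos (k - k')).
    pose proof (Rabs_pos (sin p - sin p')).
    assert (k * Rabs (sin p - sin p') <= coth l * Rabs (p - p')) by (apply Rmult_le_compat; lra).
    assert (Rabs (sin p') * Rabs (k - k') <= 1 * (/ (sinh l * sinh l) * Rabs (r - r')))
      by (apply Rmult_le_compat; lra).
    unfold K.
    assert (0 <= (2 + coth l) * Rabs (r - r')) by (apply Rmult_le_pos; lra).
    assert (0 <= / (sinh l * sinh l) * Rabs (p - p')) by (apply Rmult_le_pos; lra).
    lra.
  - intros p r p' r'. apply Rle_trans with (1 := cos_lipschitz p p').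
    pose proof (Rabs_pos (p - p')). pose proof (Rabs_pos (r - r')). unfold K.
    assert (0 <= (1 + coth l + / (sinh l * sinh l)) * Rabs (p - p')) by (apply Rmult_le_pos; lra).
    assert (0 <= (2 + coth l + / (sinh l * sinh l)) * Rabs (r - r')) by (apply Rmult_le_pos; lra).
    lra.
  (* The field does not involve the height, so the system to solve is planar and [z] is a
     quadrature. *)
  - exists phi, r, (fun t => 0 + RInt (fun s => sin (phi s)) 0 t).
    repeat (split; [assumption|]). apply is_derive_primitive.
    intros t. apply (ex_derive_continuous (fun s => sin (phi s))). auto_derive.
    eexists; apply H3.
Qed.

(** Squaring makes the negative part differentiable at 0, so that it can serve as a barrier
    function. *)
Lemma is_derive_Rmin_sq (x : R) : is_derive (fun x => Rmin x 0 ^ 2) x (2 * Rmin x 0).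
Proof.
  apply is_derive_Reals. intros eps He. exists (mkposreal eps He). simpl. intros h Hh Hhe.
  assert (H : Rabs (Rmin (x + h) 0 ^ 2 - Rmin x 0 ^ 2 - 2 * Rmin x 0 * h) <= Rabs h * Rabs h).
  { rewrite <- Rabs_mult, (Rabs_pos_eq (h * h)) by nra.
    apply Rabs_le. unfold Rmin. repeat destruct Rle_dec; nra. }
  simpl in H.
  replace ((Rmin (x + h) 0 * (Rmin (x + h) 0 * 1) - Rmin x 0 * (Rmin x 0 * 1)) / h - 2 * Rmin x 0)
    with ((Rmin (x + h) 0 * (Rmin (x + h) 0 * 1) - Rmin x 0 * (Rmin x 0 * 1) - 2 * Rmin x 0 * h) / h)
    by (field; trivial).
  unfold Rdiv. rewrite Rabs_mult, Rabs_inv. pose proof (Rabs_pos_lt h Hh) as Hp.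
  apply Rle_lt_trans with (2 := Hhe).
  apply Rmult_le_reg_r with (Rabs h); trivial.
  rewrite Rmult_assoc, Rinv_l, Rmult_1_r by lra. exact H.
Qed.

(** Below the level [d] the function climbs with speed at least [k], so it reaches [d]. From then on
    the squared negative part of [g - d] starts at 0 and cannot increase, so [g] never falls
    back. *)
Lemma eventually_above (g dg : R -> R) (a d k : R) : 0 < k ->
  (forall t, a <= t -> is_derive g t (dg t)) ->
  (forall t, a <= t -> g t < d -> k <= dg t) ->
  exists T, a <= T /\ forall t, T <= t -> d <= g t.
Proof.
  intros Hk Hg Hd.
  destruct (classic (exists T, a <= T /\ d <= g T)) as [[T [HT HgT]]|Hno].
  - exists T. split; trivial. intros t Ht.
    assert (H : - (Rmin (g T - d) 0 ^ 2) <= - (Rmin (g t - d) 0 ^ 2)).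
    { apply (derive_nonneg_le (fun s => - (Rmin (g s - d) 0 ^ 2))
               (fun s => - (2 * Rmin (g s - d) 0 * dg s))); trivial.
      - intros s Hs. apply @is_derive_opp.
        replace (2 * Rmin (g s - d) 0 * dg s) with (scal (dg s) (2 * Rmin (g s - d) 0))
          by (unfold scal; simpl; unfold mult; simpl; ring).
        apply (is_derive_comp (fun x => Rmin x 0 ^ 2) (fun s => g s - d)).
        + apply is_derive_Rmin_sq.
        + replace (dg s) with (minus (dg s) zero) by (unfold minus, plus, opp, zero; simpl; ring).
          apply @is_derive_minus; [apply Hg; lra | apply @is_derive_const].
      - intros s Hs. unfold Rmin. destruct Rle_dec; [|lra].
        destruct (Req_dec (g s - d) 0) as [->|]; [lra|].
        specialize (Hd s ltac:(lra) ltac:(lra)). nra. }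
    rewrite (Rmin_right (g T - d)) in H by lra.
    unfold Rmin in H. destruct Rle_dec; nra.
  - exfalso. set (T := Rabs (d - g a) / k + 1).
    assert (HT : 0 < T).
    { unfold T. assert (0 <= Rabs (d - g a) / k); [|lra].
      apply Rmult_le_pos; [apply Rabs_pos | left; now apply Rinv_0_lt_compat]. }
    assert (Hlow : forall t, a <= t -> g t < d).
    { intros t Ht. apply Rnot_le_lt. intros H. apply Hno. now exists t. }
    assert (H : g a - k * a <= g (a + T) - k * (a + T)).
    { apply (derive_nonneg_le (fun s => g s - k * s) (fun s => dg s - k)); [lra| |].
      - intros s Hs. apply @is_derive_minus; [apply Hg; lra|].
        auto_derive; [trivial|ring].
      - intros s Hs. specialize (Hd s ltac:(lra) (Hlow s ltac:(lra))). lra. }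
    pose proof (Hlow (a + T) ltac:(lra)). pose proof (Rle_abs (d - g a)).
    assert (k * T = Rabs (d - g a) + k) by (unfold T; field; lra). nra.
Qed.

(** * One end of the profile, with any coefficient [c] in [[1, C]] in place of [coth r] *)

Section ProfileEnd.

Context (phi z c : R -> R) (C : R).
Context (Hc : forall t, 1 <= c t <= C).
Context (phi_0 : cos (phi 0) = 0).
Context (phi_d : forall t, is_derive phi t (2 * cos (phi t) - c t * sin (phi t))).
Context (z_d : forall t, is_derive z t (sin (phi t))).

(* The factor [exp (2 z)] removes the cross term: the derivative becomes [c sin^2 phi exp (2 z) >= 0]. *)
Lemma profile_end_cos_pos (t : R) : 0 < t -> 0 < cos (phi t).
Proof.
  intros Ht. set (G := fun t => cos (phi t) * exp (2 * z t)).
  assert (HG : forall s, is_derive G s (c s * (sin (phi s) * sin (phi s)) * exp (2 * z s))).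
  { intros s. unfold G. auto_derive.
    - repeat split; [eexists; apply phi_d | eexists; apply z_d].
    - replace (Derive (fun x => phi x) s) with (2 * cos (phi s) - c s * sin (phi s))
        by (symmetry; apply (is_derive_unique phi), phi_d).
      replace (Derive (fun x => z x) s) with (sin (phi s))
        by (symmetry; apply (is_derive_unique z), z_d).
      ring. }
  assert (mono : forall s s', s <= s' -> G s <= G s').
  { intros s s' Hs. apply (derive_nonneg_le _ _ _ _ Hs (fun u _ => HG u)).
    intros u _. pose proof (exp_pos (2 * z u)). specialize (Hc u).
    apply Rmult_le_pos; [|lra]. apply Rmult_le_pos; [lra|nra]. }
  assert (G0 : G 0 = 0) by (unfold G; rewrite phi_0; ring).
  (* Strictness: otherwise the monotone [G] vanishes on [[0, t]], so its derivative vanishes at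
     [t / 2], and sine and cosine of one angle are both 0. *)
  assert (pos : G t <= 0 -> False).
  { intros Hneg.
    assert (Z : forall s, 0 <= s <= t -> G s = 0).
    { intros s Hs. pose proof (mono 0 s). pose proof (mono s t). lra. }
    assert (D0 : is_derive G (t / 2) 0).
    { apply (is_derive_ext_loc (fun _ => 0)); [|apply @is_derive_const].
      exists (mkposreal (t / 2) ltac:(lra)). intros s Hs.
      apply Rabs_def2 in Hs. unfold minus, plus, opp in Hs; simpl in Hs.
      symmetry; apply Z. lra. }
    pose proof (is_derive_unique _ _ _ D0) as E1.
    rewrite (is_derive_unique _ _ _ (HG (t / 2))) in E1.
    pose proof (Z (t / 2) ltac:(lra)) as E2. unfold G in E2.
    pose proof (exp_pos (2 * z (t / 2))) as He. specialize (Hc (t / 2)).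
    apply Rmult_integral in E1. destruct E1 as [E1|E1]; [|lra].
    apply Rmult_integral in E1. destruct E1 as [E1|E1]; [lra|].
    apply Rmult_integral in E2. destruct E2 as [E2|E2]; [|lra].
    pose proof (sq_sin_cos (phi (t / 2))). rewrite E2 in *. lra. }
  apply Rnot_le_lt. intros H. apply pos. unfold G.
  pose proof (exp_pos (2 * z t)). nra.
Qed.

(* The slope [w = tan phi] satisfies [w' = (2 - c w) / cos phi], which traps it in [1/C, 3]. *)
Lemma profile_end_slope : exists T d, 0 < d /\
  forall t, T <= t -> 1 / 4 <= cos (phi t) /\ d <= sin (phi t).
Proof.
  assert (HC : 0 < C) by (specialize (Hc 0); lra).
  set (w := fun t => sin (phi t) / cos (phi t)).
  set (dw := fun t => (2 - c t * w t) / cos (phi t)).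
  assert (Hu : forall t, 1 <= t -> 0 < cos (phi t) <= 1).
  { intros t Ht. pose proof (COS_bound (phi t)). split; [apply profile_end_cos_pos|]; lra. }
  assert (Hw : forall t, 1 <= t -> is_derive w t (dw t)).
  { intros t Ht. specialize (Hu t Ht). unfold w. auto_derive.
    - repeat split; try (eexists; apply phi_d). lra.
    - replace (Derive (fun x => phi x) t) with (2 * cos (phi t) - c t * sin (phi t))
        by (symmetry; apply (is_derive_unique phi), phi_d).
      transitivity ((2 * cos (phi t) - c t * sin (phi t))
                    * (sin (phi t) * sin (phi t) + cos (phi t) * cos (phi t)) / cos (phi t) ^ 2).
      + field. lra.
      + rewrite sq_sin_cos. unfold dw, w. field. lra. }
  assert (HiC : 0 < / C) by now apply Rinv_0_lt_compat.
  assert (EC : C * / C = 1) by (apply Rinv_r; lra).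
  (* The tangent is vertical at the neck, so the slope is followed from time 1 on. Below [1 / C] one
     has [c w <= 1], above 3 one has [c w > 3]; since [0 < cos phi <= 1], the slope moves towards
     the trap with speed at least 1 in both cases. *)
  destruct (eventually_above w dw 1 (/ C) 1) as [T1 [HT1 H1]]; trivial; [lra| |].
  { intros t Ht Hlt. specialize (Hu t Ht). specialize (Hc t).
    assert (c t * w t <= 1) by (destruct (Rle_dec 0 (w t)); nra).
    unfold dw. apply Rmult_le_reg_r with (cos (phi t)); [lra|].
    unfold Rdiv. rewrite Rmult_assoc, Rinv_l by lra. lra. }
  destruct (eventually_above (fun t => - w t) (fun t => - dw t) 1 (-3) 1) as [T2 [HT2 H2]]; [lra| | |].
  { intros t Ht. apply @is_derive_opp, Hw, Ht. }
  { intros t Ht Hlt. specialize (Hu t Ht). specialize (Hc t).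
    unfold dw. apply Rmult_le_reg_r with (cos (phi t)); [lra|].
    unfold Rdiv. rewrite Ropp_mult_distr_l, Rmult_assoc, Rinv_l by lra. nra. }
  exists (Rmax T1 T2), (/ C * / 4). split; [apply Rmult_lt_0_compat; lra|].
  intros t Ht. pose proof (Rmax_l T1 T2). pose proof (Rmax_r T1 T2).
  specialize (H1 t ltac:(lra)). specialize (H2 t ltac:(lra)).
  specialize (Hu t ltac:(lra)).
  assert (Es : sin (phi t) = w t * cos (phi t)) by (unfold w; field; lra).
  pose proof (sq_sin_cos (phi t)) as E. rewrite Es in E.
  (* With [0 <= w <= 3], a cosine below [1 / 4] would give [sin^2 + cos^2 < 9/16 + 1/16 < 1]. *)
  assert (Hq : 1 / 4 <= cos (phi t)).
  { apply Rnot_lt_le. intros Hlt.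
    assert (0 <= w t <= 3) by lra.
    assert (0 <= w t * cos (phi t) <= 3 / 4) by (split; [apply Rmult_le_pos; lra | nra]).
    nra. }
  split; [exact Hq|]. rewrite Es. apply Rmult_le_compat; lra.
Qed.

End ProfileEnd.

(** The curve comes down one wing and goes up the other. On the left end it is traversed towards the
    neck, so the negative bounds on cosine and sine say that radius and height grow as [t] tends to
    minus infinity. *)
Definition profile (l : R) (phi r z : R -> R) : Prop :=
  r 0 = l /\ (forall t, l <= r t) /\
  (forall t, is_derive phi t (2 * cos (phi t) - coth (r t) * sin (phi t))) /\
  (forall t, is_derive r t (cos (phi t))) /\
  (forall t, is_derive z t (sin (phi t))) /\
  (forall t, 0 < t -> 0 < cos (phi t)) /\
  (forall t, t < 0 -> cos (phi t) < 0) /\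
  (exists T d, 0 < d /\ forall t, T <= t -> 1 / 4 <= cos (phi t) /\ d <= sin (phi t)) /\
  (exists T d, 0 < d /\ forall t, t <= - T -> cos (phi t) <= - (1 / 4) /\ sin (phi t) <= - d).

Lemma is_derive_reverse (f : R -> R) (df t : R) :
  is_derive f (- t) df -> is_derive (fun t => f (- t)) t (- df).
Proof.
  intros H. replace (- df) with (scal (-1) df) by (unfold scal; simpl; unfold mult; simpl; ring).
  apply (is_derive_comp f Ropp); trivial. auto_derive; [trivial|ring].
Qed.

Lemma profile_exists (l : R) : 0 < l -> exists phi r z, profile l phi r z.
Proof.
  intros Hl.
  destruct (truncated_profile l Hl) as (phi & r & z & phi0 & r0 & dphi & dr & dz).
  set (c := fun t => coth (Rmax l (r t))) in *.
  assert (Hc : forall t, 1 <= c t <= coth l).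
  { intros t. unfold c. pose proof (Rmax_l l (r t)).
    pose proof (coth_gt_1 (Rmax l (r t))). pose proof (coth_decreasing l (Rmax l (r t)) Hl). lra. }
  (* Traversing the curve backwards and turning the tangent by PI gives a solution of the same system. *)
  set (psi := fun t => phi (- t) - PI).
  assert (cpsi : forall t, cos (psi t) = - cos (phi (- t))).
  { intros t. unfold psi. rewrite cos_minus, cos_PI, sin_PI. ring. }
  assert (spsi : forall t, sin (psi t) = - sin (phi (- t))).
  { intros t. unfold psi. rewrite sin_minus, cos_PI, sin_PI. ring. }
  assert (c0 : cos (phi 0) = 0) by (rewrite phi0; apply cos_PI2).
  assert (c0' : cos (psi 0) = 0) by (rewrite cpsi, Ropp_0, c0; ring).
  assert (dpsi : forall t, is_derive psi t (2 * cos (psi t) - c (- t) * sin (psi t))).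
  { intros t. rewrite cpsi, spsi. unfold psi.
    replace (2 * - cos (phi (- t)) - c (- t) * - sin (phi (- t)))
      with (minus (- (2 * cos (phi (- t)) - c (- t) * sin (phi (- t)))) zero)
      by (unfold minus, plus, opp, zero; simpl; ring).
    apply @is_derive_minus; [|apply @is_derive_const].
    apply (is_derive_reverse phi), dphi. }
  assert (dz' : forall t, is_derive (fun t => z (- t)) t (sin (psi t))).
  { intros t. rewrite spsi. apply (is_derive_reverse z), dz. }
  pose proof (profile_end_cos_pos phi z c (coth l) Hc c0 dphi dz) as pos.
  pose proof (profile_end_cos_pos psi (fun t => z (- t)) (fun t => c (- t)) (coth l)
                (fun t => Hc (- t)) c0' dpsi dz') as pos'.
  destruct (profile_end_slope phi z c (coth l) Hc c0 dphi dz) as (T & d & Hd & HT).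
  destruct (profile_end_slope psi (fun t => z (- t)) (fun t => c (- t)) (coth l)
                (fun t => Hc (- t)) c0' dpsi dz') as (T' & d' & Hd' & HT').
  assert (neg : forall t, t < 0 -> cos (phi t) < 0).
  { intros t Ht. pose proof (pos' (- t) ltac:(lra)) as H. rewrite cpsi, Ropp_involutive in H. lra. }
  assert (rl : forall t, l <= r t).
  { intros t. rewrite <- r0. destruct (Rle_dec 0 t).
    - apply (derive_nonneg_le r (fun t => cos (phi t))); trivial.
      intros s Hs. destruct (Req_dec s 0) as [->|]; [lra|]. left; apply pos; lra.
    - apply Ropp_le_cancel.
      apply (derive_nonneg_le (fun t => - r t) (fun t => - cos (phi t))); [lra| |].
      + intros s _. apply @is_derive_opp, dr.
      + intros s Hs. destruct (Req_dec s 0) as [->|]; [lra|]. specialize (neg s). lra. }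
  exists phi, r, z. unfold profile.
  do 2 (split; [assumption|]). split.
  (* Since [l <= r t], the cut-off is inactive and the genuine equation holds. *)
  { intros t. specialize (dphi t). unfold c in dphi. rewrite Rmax_right in dphi by apply rl.
    exact dphi. }
  do 4 (split; [assumption|]). split.
  - now exists T, d.
  - exists T', d'. split; trivial. intros t Ht. specialize (HT' (- t) ltac:(lra)).
    rewrite cpsi, spsi, Ropp_involutive in HT'. lra.
Qed.

Lemma linear_growth (f df : R -> R) (T d : R) : 0 < d ->
  (forall t, is_derive f t (df t)) -> (forall t, T <= t -> d <= df t) ->
  forall B, exists T', forall t, T' < t -> B < f t.
Proof.
  intros Hd Hf Hdf B. exists (T + Rabs (B - f T) / d).
  assert (H0 : 0 <= Rabs (B - f T) / d).
  { apply Rmult_le_pos; [apply Rabs_pos | left; now apply Rinv_0_lt_compat]. }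
  intros t Ht.
  assert (H : f T - d * T <= f t - d * t).
  { apply (derive_nonneg_le (fun s => f s - d * s) (fun s => df s - d)); [lra| |].
    - intros s _. apply @is_derive_minus; [apply Hf | auto_derive; [trivial|ring]].
    - intros s Hs. specialize (Hdf s). lra. }
  assert (Rabs (B - f T) < d * (t - T)).
  { apply Rmult_lt_reg_r with (/ d); [now apply Rinv_0_lt_compat|].
    replace (d * (t - T) * / d) with (t - T) by (field; lra). unfold Rdiv in *. lra. }
  pose proof (Rle_abs (B - f T)). lra.
Qed.

Lemma derive_pos_lt (f df : R -> R) (a b : R) : a < b ->
  (forall t, is_derive f t (df t)) -> (forall t, a <= t <= b -> 0 < df t) -> f a < f b.
Proof.
  intros Hab Hf Hdf. destruct (MVT_gen f a b df) as [c [Hc E]].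
  - intros; apply Hf.
  - intros u _. apply continuity_pt_filterlim, (ex_derive_continuous f u). eexists; apply Hf.
  - rewrite Rmin_left, Rmax_right in Hc by lra. specialize (Hdf c Hc). nra.
Qed.

Lemma angle_exists (u v : R) : u * u + v * v = 1 -> exists th, cos th = u /\ sin th = v.
Proof.
  intros H. assert (Hu : -1 <= u <= 1) by nra.
  assert (Hs : sqrt (1 - Rsqr u) = Rabs v).
  { rewrite <- sqrt_Rsqr_abs. f_equal. unfold Rsqr. lra. }
  destruct (Rle_dec 0 v) as [Hv|Hv].
  - exists (acos u). rewrite cos_acos, sin_acos, Hs, Rabs_pos_eq by trivial. now split.
  - exists (- acos u). rewrite cos_neg, sin_neg, cos_acos, sin_acos, Hs, Rabs_left by lra.
    split; ring.
Qed.

Lemma angle_unique (a b : R) : cos a = cos b -> sin a = sin b ->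
  exists k : Z, b = a + 2 * PI * IZR k.
Proof.
  intros Hc Hs.
  assert (H : sin ((b - a) / 2) = 0).
  { assert (E : cos (2 * ((b - a) / 2)) = 1).
    { replace (2 * ((b - a) / 2)) with (b - a) by field.
      rewrite cos_minus, Hc, Hs. pose proof (sq_sin_cos b). lra. }
    rewrite cos_2a_sin in E. nra. }
  destruct (sin_eq_0_0 _ H) as [k Hk]. exists k. lra.
Qed.

(** * Smooth functions of two variables *)

Lemma cont2_iff (f : R -> R -> R) :
  cont2 f <-> forall th t, continuity_2d_pt f th t.
Proof.
  split.
  - intros H th t eps. destruct (H th t eps (cond_pos eps)) as (d & Hd & H').
    now exists (mkposreal d Hd).
  - intros H th t eps He. destruct (H th t (mkposreal eps He)) as [d Hd].
    exists d. split; [apply cond_pos | exact Hd].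
Qed.

Lemma cont2_of_fst (f : R -> R) :
  (forall x, continuous f x) -> cont2 (fun th _ => f th).
Proof.
  intros H th t eps He. destruct (proj1 (filterlim_locally f (f th)) (H th) (mkposreal eps He)) as [d Hd].
  exists d. split; [apply cond_pos|]. intros th' t' Hth _. apply Hd, Hth.
Qed.

Lemma cont2_of_snd (f : R -> R) :
  (forall x, continuous f x) -> cont2 (fun _ t => f t).
Proof.
  intros H th t eps He. destruct (proj1 (filterlim_locally f (f t)) (H t) (mkposreal eps He)) as [d Hd].
  exists d. split; [apply cond_pos|]. intros th' t' _ Ht. apply Hd, Ht.
Qed.

(** Partial derivatives are witnesses, not iterated [Derive] terms, so closure under sums, products
    and inverses follows by induction on the order. All mixed derivatives are included. *)
Fixpoint smooth (n : nat) (f : R -> R -> R) : Prop :=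
  cont2 f /\
  match n with
  | O => True
  | S n => exists f1 f2 : R -> R -> R,
      (forall th t, is_derive (fun s => f s t) th (f1 th t)) /\
      (forall th t, is_derive (fun s => f th s) t (f2 th t)) /\
      smooth n f1 /\ smooth n f2
  end.

Lemma smooth_cont2 (n : nat) (f : R -> R -> R) : smooth n f -> cont2 f.
Proof. destruct n; intros [H _]; exact H. Qed.

Lemma smooth_pred (n : nat) (f : R -> R -> R) : smooth (S n) f -> smooth n f.
Proof.
  revert f. induction n as [|n IH]; intros f [Hc (f1 & f2 & H1 & H2 & S1 & S2)].
  - now split.
  - split; [exact Hc|]. exists f1, f2. auto.
Qed.

Lemma smooth_const (n : nat) (c : R) : smooth n (fun _ _ => c).
Proof.
  revert c. induction n as [|n IH]; intros c; split;
    try (apply cont2_iff; intros; apply continuity_2d_pt_const); trivial.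
  exists (fun _ _ => 0), (fun _ _ => 0). split; [|split; [|split; apply IH]];
    intros; apply @is_derive_const.
Qed.

Lemma smooth_plus (n : nat) (f g : R -> R -> R) :
  smooth n f -> smooth n g -> smooth n (fun th t => f th t + g th t).
Proof.
  revert f g. induction n as [|n IH]; intros f g Hf Hg; split;
    try (apply cont2_iff; intros; apply continuity_2d_pt_plus;
         apply cont2_iff; eapply smooth_cont2; eassumption); trivial.
  destruct Hf as [_ (f1 & f2 & F1 & F2 & F3 & F4)].
  destruct Hg as [_ (g1 & g2 & G1 & G2 & G3 & G4)].
  exists (fun th t => f1 th t + g1 th t), (fun th t => f2 th t + g2 th t).
  split; [|split; [|auto]]; intros th t.
  - apply (is_derive_plus (fun s => f s t) (fun s => g s t)); auto.
  - apply (is_derive_plus (fun s => f th s) (fun s => g th s)); auto.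
Qed.

Lemma smooth_mult (n : nat) (f g : R -> R -> R) :
  smooth n f -> smooth n g -> smooth n (fun th t => f th t * g th t).
Proof.
  revert f g. induction n as [|n IH]; intros f g Hf Hg; split;
    try (apply cont2_iff; intros; apply continuity_2d_pt_mult;
         apply cont2_iff; eapply smooth_cont2; eassumption); trivial.
  pose proof (smooth_pred _ _ Hf). pose proof (smooth_pred _ _ Hg).
  destruct Hf as [_ (f1 & f2 & F1 & F2 & F3 & F4)].
  destruct Hg as [_ (g1 & g2 & G1 & G2 & G3 & G4)].
  exists (fun th t => f1 th t * g th t + f th t * g1 th t),
    (fun th t => f2 th t * g th t + f th t * g2 th t).
  split; [|split; [|split; apply smooth_plus; auto]]; intros th t.
  - apply (is_derive_mult (fun s => f s t) (fun s => g s t)); auto. exact Rmult_comm.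
  - apply (is_derive_mult (fun s => f th s) (fun s => g th s)); auto. exact Rmult_comm.
Qed.

Lemma smooth_opp (n : nat) (f : R -> R -> R) :
  smooth n f -> smooth n (fun th t => - f th t).
Proof.
  intros H. replace (fun th t => - f th t) with (fun th t => -1 * f th t).
  - apply smooth_mult; [apply smooth_const | exact H].
  - do 2 (apply functional_extensionality; intro). ring.
Qed.

Lemma smooth_minus (n : nat) (f g : R -> R -> R) :
  smooth n f -> smooth n g -> smooth n (fun th t => f th t - g th t).
Proof. intros Hf Hg. apply smooth_plus; [exact Hf | now apply smooth_opp]. Qed.

Lemma smooth_inv (n : nat) (f : R -> R -> R) :
  (forall th t, f th t <> 0) -> smooth n f -> smooth n (fun th t => / f th t).
Proof.
  intros H0. induction n as [|n IH]; intros Hf; split;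
    try (apply cont2_iff; intros; apply continuity_2d_pt_inv; trivial;
         apply cont2_iff; eapply smooth_cont2; eassumption); trivial.
  specialize (IH (smooth_pred _ _ Hf)).
  destruct Hf as [_ (f1 & f2 & F1 & F2 & F3 & F4)].
  exists (fun th t => - (f1 th t * (/ f th t * / f th t))),
    (fun th t => - (f2 th t * (/ f th t * / f th t))).
  split; [|split; [|split; apply smooth_opp, smooth_mult; auto; apply smooth_mult; auto]];
    intros th t.
  - replace (- (f1 th t * (/ f th t * / f th t))) with (- f1 th t / f th t ^ 2) by (field; auto).
    apply (is_derive_inv (fun s => f s t)); auto.
  - replace (- (f2 th t * (/ f th t * / f th t))) with (- f2 th t / f th t ^ 2) by (field; auto).
    apply (is_derive_inv (fun s => f th s)); auto.
Qed.

Lemma smooth_of_fst (n : nat) (f df : R -> R) :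
  (forall x, is_derive f x (df x)) -> smooth n (fun th _ => df th) ->
  smooth (S n) (fun th _ => f th).
Proof.
  intros H Hd. split.
  - apply cont2_of_fst. intros x. apply (ex_derive_continuous f). eexists; apply H.
  - exists (fun th _ => df th), (fun _ _ => 0). split; [|split; [|split]]; trivial.
    + intros; apply @is_derive_const.
    + apply smooth_const.
Qed.

Lemma smooth_of_snd (n : nat) (f df : R -> R) :
  (forall x, is_derive f x (df x)) -> smooth n (fun _ t => df t) ->
  smooth (S n) (fun _ t => f t).
Proof.
  intros H Hd. split.
  - apply cont2_of_snd. intros x. apply (ex_derive_continuous f). eexists; apply H.
  - exists (fun _ _ => 0), (fun _ t => df t). split; [|split; [|split]]; trivial.
    + intros; apply @is_derive_const.
    + apply smooth_const.
Qed.

Lemma smooth_sin_cos (n : nat) :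
  smooth n (fun th _ => sin th) /\ smooth n (fun th _ => cos th).
Proof.
  assert (ds : forall x, is_derive sin x (cos x))
    by (intros; apply is_derive_Reals, derivable_pt_lim_sin).
  assert (dc : forall x, is_derive cos x (- sin x))
    by (intros; apply is_derive_Reals, derivable_pt_lim_cos).
  induction n as [|n [IHs IHc]].
  - split; split; trivial; apply cont2_of_fst; intros x;
      [apply (ex_derive_continuous sin) | apply (ex_derive_continuous cos)]; eexists;
      [apply ds | apply dc].
  - split.
    + now apply (smooth_of_fst n _ _ ds).
    + apply (smooth_of_fst n _ _ dc). now apply smooth_opp.
Qed.

Lemma smooth_C2 (f : R -> R -> R) : smooth 2 f -> C2 f.
Proof.
  assert (step : forall n g, smooth (S n) g -> smooth n (d1 g) /\ smooth n (d2 g) /\ partials_exist g).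
  { intros n g [_ (g1 & g2 & H1 & H2 & S1 & S2)].
    replace (d1 g) with g1; [replace (d2 g) with g2|].
    - split; [exact S1 | split; [exact S2|]]. intros th t; split; eexists; [apply H1 | apply H2].
    - do 2 (apply functional_extensionality; intro). symmetry. apply is_derive_unique, H2.
    - do 2 (apply functional_extensionality; intro). symmetry.
      apply (is_derive_unique (fun s => g s x0)), H1. }
  intros H. destruct (step _ _ H) as (H1 & H2 & P).
  destruct (step _ _ H1) as (H11 & H12 & P1). destruct (step _ _ H2) as (H21 & H22 & P2).
  unfold C2. repeat (split; [first [assumption | eapply smooth_cont2; eassumption]|]).
  eapply smooth_cont2; eassumption.
Qed.

(** * Vertical fibres and isometries *)

Definition cosh_dist (p q : vec) : R :=
  1 + ((vx p - vx q) ^ 2 + (vy p - vy q) ^ 2) / (2 * vy p * vy q).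

(** This is [cosh_dist] to the point [(0, 1)] of the half-plane, over which the axis of rotation
    stands. *)
Definition cosh_axis_dist (p : vec) : R := (vx p ^ 2 + vy p ^ 2 + 1) / (2 * vy p).

Definition vertical (p q : vec) : Prop := vx p = vx q /\ vy p = vy q.

Lemma cosh_dist_ge_1 (p q : vec) : inH2R p -> inH2R q -> 1 <= cosh_dist p q.
Proof.
  unfold inH2R, cosh_dist. intros Hp Hq.
  assert (0 <= ((vx p - vx q) ^ 2 + (vy p - vy q) ^ 2) / (2 * vy p * vy q)); [|lra].
  apply Rmult_le_pos; [apply Rplus_le_le_0_compat; apply pow2_ge_0|]. left. apply Rinv_0_lt_compat, Rmult_lt_0_compat; lra.
Qed.

Lemma acosh_1 : Defs.acosh 1 = 0.
Proof.
  unfold Defs.acosh. replace (1 * 1 - 1) with 0 by ring.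
  now rewrite sqrt_0, Rplus_0_r, ln_1.
Qed.

Lemma acosh_increasing (u v : R) : 1 <= u -> u < v -> Defs.acosh u < Defs.acosh v.
Proof.
  intros Hu Huv. unfold Defs.acosh. pose proof (sqrt_pos (u * u - 1)).
  assert (sqrt (u * u - 1) < sqrt (v * v - 1)) by (apply sqrt_lt_1; nra).
  apply ln_increasing; lra.
Qed.

Lemma acosh_nonneg (u : R) : 1 <= u -> 0 <= Defs.acosh u.
Proof.
  intros [H|<-]; [|rewrite acosh_1; lra].
  rewrite <- acosh_1. left; apply acosh_increasing; lra.
Qed.

Lemma distH2_nonneg (p q : vec) : inH2R p -> inH2R q -> 0 <= distH2 p q.
Proof. intros Hp Hq. apply acosh_nonneg. now apply (cosh_dist_ge_1 p q). Qed.

Lemma dist_sq (p q : vec) : Defs.dist p q ^ 2 = distH2 p q ^ 2 + (vz p - vz q) ^ 2.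
Proof. unfold Defs.dist. apply pow2_sqrt, Rplus_le_le_0_compat; apply pow2_ge_0. Qed.

Lemma dist_vertical (p q q' : vec) : vertical q q' -> distH2 p q = distH2 p q'.
Proof. intros [Ex Ey]. unfold distH2. now rewrite Ex, Ey. Qed.

Lemma distH2_vertical (p q : vec) : inH2R p -> vertical p q -> distH2 p q = 0.
Proof.
  intros Hp [Ex Ey]. unfold distH2. rewrite <- Ex, <- Ey.
  replace (1 + _) with 1; [apply acosh_1|]. unfold inH2R in Hp. field. lra.
Qed.

(* Apollonius' identity for the median of the triangle [q a b], which characterizes vertical
   segments [a b] by metric data. *)
Definition apollonius (a b m : vec) : Prop := forall q, inH2R q ->
  Defs.dist q a ^ 2 + Defs.dist q b ^ 2 = 2 * Defs.dist q m ^ 2 + Defs.dist a b ^ 2 / 2.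

(** The points [a], [b] and their midpoint have equal horizontal distance to [q], so only the median
    identity on the real line remains. *)
Lemma vertical_apollonius (a b : vec) : inH2R a -> vertical a b ->
  exists m, inH2R m /\ apollonius a b m.
Proof.
  intros Ha Hab. set (m := (vx a, vy a, (vz a + vz b) / 2) : vec).
  exists m. split; [exact Ha|].
  intros q Hq. rewrite !dist_sq, (distH2_vertical a b Ha Hab).
  rewrite (dist_vertical q b a), (dist_vertical q m a) by (destruct Hab; now split).
  change (vz m) with ((vz a + vz b) / 2). field.
Qed.

Lemma quartic_zero (c4 c3 c2 c1 c0 : R) :
  (forall x, c4 * x ^ 4 + c3 * x ^ 3 + c2 * x ^ 2 + c1 * x + c0 = 0) ->
  c4 = 0 /\ c3 = 0 /\ c2 = 0 /\ c1 = 0 /\ c0 = 0.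
Proof.
  intros H. pose proof (H 0). pose proof (H 1). pose proof (H (-1)).
  pose proof (H 2). pose proof (H (-2)). repeat split; lra.
Qed.

(* Near the boundary point [x] of the half-plane, [distH2 (x,y) a = - ln y + ln (horo a x y)], with
   [horo a x] continuous up to [y = 0]: a Busemann function. *)
Definition horo (a : vec) (x y : R) : R :=
  (y + ((x - vx a) ^ 2 + (y - vy a) ^ 2) / (2 * vy a))
  + sqrt ((y + ((x - vx a) ^ 2 + (y - vy a) ^ 2) / (2 * vy a)) ^ 2 - y ^ 2).

(** At the boundary the radicand is a perfect square, and the value is, up to a constant factor, the
    reciprocal of the Poisson kernel of the half-plane. *)
Lemma horo_0 (a : vec) (x : R) : inH2R a ->
  horo a x 0 = ((x - vx a) ^ 2 + vy a ^ 2) / vy a /\ 0 < horo a x 0.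
Proof.
  unfold inH2R. intros Ha.
  assert (Hp : 0 < ((x - vx a) ^ 2 + vy a ^ 2) / vy a).
  { pose proof (pow2_ge_0 (x - vx a)). pose proof (pow_lt (vy a) 2 Ha).
    apply Rdiv_lt_0_compat; lra. }
  assert (E : horo a x 0 = ((x - vx a) ^ 2 + vy a ^ 2) / vy a).
  { unfold horo.
    replace ((0 + ((x - vx a) ^ 2 + (0 - vy a) ^ 2) / (2 * vy a)) ^ 2 - 0 ^ 2)
      with ((((x - vx a) ^ 2 + vy a ^ 2) / vy a / 2) ^ 2) by (field; lra).
    rewrite sqrt_pow2 by lra. field. lra. }
  split; [exact E | now rewrite E].
Qed.

Lemma distH2_horo (a : vec) (x y w : R) : inH2R a -> 0 < y ->
  distH2 (x, y, w) a = - ln y + ln (horo a x y).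
Proof.
  unfold inH2R. intros Ha Hy.
  change (distH2 (x, y, w) a)
    with (Defs.acosh (1 + ((x - vx a) ^ 2 + (y - vy a) ^ 2) / (2 * y * vy a))).
  set (u := 1 + ((x - vx a) ^ 2 + (y - vy a) ^ 2) / (2 * y * vy a)).
  assert (Hu : 1 <= u).
  { unfold u. assert (0 <= ((x - vx a) ^ 2 + (y - vy a) ^ 2) / (2 * y * vy a)); [|lra].
    apply Rmult_le_pos; [apply Rplus_le_le_0_compat; apply pow2_ge_0|]. left; apply Rinv_0_lt_compat, Rmult_lt_0_compat; lra. }
  assert (E : y * u = y + ((x - vx a) ^ 2 + (y - vy a) ^ 2) / (2 * vy a)).
  { unfold u. field. lra. }
  unfold horo. rewrite <- E. unfold Defs.acosh.
  replace ((y * u) ^ 2 - y ^ 2) with (y ^ 2 * (u * u - 1)) by ring.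
  rewrite sqrt_mult_alt, sqrt_pow2 by nra. rewrite <- Rmult_plus_distr_l.
  pose proof (sqrt_pos (u * u - 1)). rewrite ln_mult by lra. ring.
Qed.

Lemma ln_horo_continuous (a : vec) (x : R) : inH2R a ->
  continuity_pt (fun y => ln (horo a x y)) 0.
Proof.
  intros Ha. destruct (horo_0 a x Ha) as [E Hp]. unfold inH2R in Ha.
  apply (continuity_pt_comp (horo a x) ln).
  - unfold horo. apply continuity_pt_filterlim.
    apply (continuous_plus (fun y => y + ((x - vx a) ^ 2 + (y - vy a) ^ 2) / (2 * vy a))
      (fun y => sqrt ((y + ((x - vx a) ^ 2 + (y - vy a) ^ 2) / (2 * vy a)) ^ 2 - y ^ 2))).
    + apply @ex_derive_continuous. auto_derive. lra.
    + apply (continuous_comp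
        (fun y => (y + ((x - vx a) ^ 2 + (y - vy a) ^ 2) / (2 * vy a)) ^ 2 - y ^ 2) sqrt).
      * apply @ex_derive_continuous. auto_derive. lra.
      * apply continuous_sqrt.
  - apply continuity_pt_filterlim, @ex_derive_continuous. auto_derive. exact Hp.
Qed.

(** Test the identity at [q = (x, exp (-n), 0)], whose horizontal distance to [c] is [n + l c n]
    with [l c n] convergent. The [n^2] terms cancel, and dividing by [n] kills all but the cross
    term, so [l a n + l b n - 2 l m n] tends to 0. *)
Lemma horo_median (a b m : vec) : inH2R a -> inH2R b -> inH2R m -> apollonius a b m ->
  forall x, horo a x 0 * horo b x 0 = horo m x 0 ^ 2.
Proof.
  intros Ha Hb Hm H x.
  pose (l := fun c n => ln (horo c x (exp (- INR n)))).
  assert (Lexp : is_lim_seq (fun n => exp (- INR n)) 0).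
  { apply (is_lim_comp_seq exp (fun n => - INR n) m_infty); [apply is_lim_exp_m| |].
    - exists O. intros; discriminate.
    - apply (is_lim_seq_opp INR p_infty), is_lim_seq_INR. }
  assert (Ll : forall c, inH2R c -> is_lim_seq (l c) (ln (horo c x 0))).
  { intros c Hc. apply (is_lim_seq_continuous (fun y => ln (horo c x y))); [|exact Lexp].
    now apply ln_horo_continuous. }
  set (k := Defs.dist a b ^ 2 / 2 - vz a ^ 2 - vz b ^ 2 + 2 * vz m ^ 2).
  assert (E : forall n, 2 * INR n * (l a n + l b n - 2 * l m n)
                 = k - (l a n * l a n + l b n * l b n - 2 * (l m n * l m n))).
  { intros n. pose proof (exp_pos (- INR n)) as He.
    pose proof (H (x, exp (- INR n), 0) He) as Hn. rewrite !dist_sq in Hn.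
    rewrite !distH2_horo in Hn by trivial. rewrite ln_exp in Hn.
    rewrite <- dist_sq in Hn. unfold vz at 1 3 5 in Hn; simpl snd in Hn.
    change (ln (horo a x (exp (- INR n)))) with (l a n) in Hn.
    change (ln (horo b x (exp (- INR n)))) with (l b n) in Hn.
    change (ln (horo m x (exp (- INR n)))) with (l m n) in Hn.
    unfold k. lra. }
  assert (L0 : is_lim_seq (fun n => l a n + l b n - 2 * l m n) 0).
  { apply (is_lim_seq_ext_loc (fun n =>
      (k - (l a n * l a n + l b n * l b n - 2 * (l m n * l m n))) * (/ 2 * / INR n))).
    - exists 1%nat. intros n Hn. rewrite <- E.
      assert (0 < INR n) by (apply lt_0_INR; lia). field. lra.
    - replace (Finite 0) with (Finite ((k - (ln (horo a x 0) * ln (horo a x 0)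
        + ln (horo b x 0) * ln (horo b x 0) - 2 * (ln (horo m x 0) * ln (horo m x 0))))
        * (/ 2 * 0))) by (f_equal; ring).
      apply is_lim_seq_mult'.
      + apply is_lim_seq_minus'; [apply is_lim_seq_const|].
        apply is_lim_seq_minus'; [apply is_lim_seq_plus'|];
          repeat apply is_lim_seq_mult'; auto; apply is_lim_seq_const.
      + apply is_lim_seq_mult'; [apply is_lim_seq_const|].
        apply (is_lim_seq_inv INR p_infty); [apply is_lim_seq_INR | discriminate]. }
  assert (L1 : is_lim_seq (fun n => l a n + l b n - 2 * l m n)
                 (ln (horo a x 0) + ln (horo b x 0) - 2 * ln (horo m x 0))).
  { apply is_lim_seq_minus'; [apply is_lim_seq_plus'; auto|].
    apply is_lim_seq_mult'; [apply is_lim_seq_const | auto]. }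
  pose proof (is_lim_seq_unique _ _ L0) as U0. rewrite (is_lim_seq_unique _ _ L1) in U0.
  injection U0 as U0.
  destruct (horo_0 a x Ha) as [_ Pa]. destruct (horo_0 b x Hb) as [_ Pb].
  destruct (horo_0 m x Hm) as [_ Pm].
  apply ln_inv; [nra | nra|].
  rewrite ln_mult by trivial. replace (horo m x 0 ^ 2) with (horo m x 0 * horo m x 0) by ring.
  rewrite ln_mult by trivial. lra.
Qed.

(** With [Q c = (x - vx c)^2 + vy c^2], the boundary identity reads
    [vy m^2 Q a Q b = vy a vy b (Q m)^2] as polynomials in [x], and the complex roots of [Q c]
    determine the fibre of [c]. In the variable [s = x - vx m], the coefficients of degree 4 and 3
    give [vy m^2 = vy a vy b] and [e = - d], the constant one [d = 0], the quadratic one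
    [vy a = vy b]. *)
Lemma apollonius_vertical (a b m : vec) : inH2R a -> inH2R b -> inH2R m ->
  apollonius a b m -> vertical a b.
Proof.
  intros Ha Hb Hm H.
  pose proof (horo_median a b m Ha Hb Hm H) as HP.
  destruct (quartic_zero (vy m ^ 2 - vy a * vy b)
    (- 2 * (vx a - vx m + (vx b - vx m)) * vy m ^ 2)
    (((vx a - vx m) ^ 2 + vy a ^ 2 + (vx b - vx m) ^ 2 + vy b ^ 2
       + 4 * (vx a - vx m) * (vx b - vx m)) * vy m ^ 2 - 2 * vy a * vy b * vy m ^ 2)
    (- 2 * ((vx a - vx m) * ((vx b - vx m) ^ 2 + vy b ^ 2)
       + (vx b - vx m) * ((vx a - vx m) ^ 2 + vy a ^ 2)) * vy m ^ 2)
    (((vx a - vx m) ^ 2 + vy a ^ 2) * ((vx b - vx m) ^ 2 + vy b ^ 2) * vy m ^ 2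
       - vy a * vy b * vy m ^ 4)) as (c4 & c3 & c2 & _ & c0).
  { intros s. pose proof (HP (vx m + s)) as E.
    rewrite (proj1 (horo_0 a _ Ha)), (proj1 (horo_0 b _ Hb)), (proj1 (horo_0 m _ Hm)) in E.
    unfold inH2R in *.
    apply (f_equal (fun v => v * (vy a * vy b * vy m ^ 2))) in E.
    field_simplify in E; [|lra..]. field_simplify. lra. }
  unfold inH2R in *. set (d := vx a - vx m) in *. set (e := vx b - vx m) in *.
  assert (Hm2 : 0 < vy m ^ 2) by nra.
  assert (He : e = - d) by nra.
  rewrite He in c0, c2.
  assert (Em : vy m ^ 2 = vy a * vy b) by lra.
  replace (vy m ^ 4) with (vy m ^ 2 * vy m ^ 2) in c0 by ring. rewrite Em in c0, c2.
  assert (Hab : 0 < vy a * vy b) by nra.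
  assert (D0 : (d * d) * (d * d + vy a ^ 2 + vy b ^ 2) = 0).
  { apply Rmult_eq_reg_r with (vy a * vy b); nra. }
  assert (Hd : d = 0).
  { apply Rmult_integral in D0. destruct D0 as [D0|D0]; nra. }
  split.
  - unfold d, e in *. lra.
  - rewrite Hd in c2. assert ((vy a - vy b) * (vy a - vy b) = 0); [|nra].
    apply Rmult_eq_reg_r with (vy a * vy b); nra.
Qed.

(** Two points of a disc are at most a diameter apart: if [c = cosh r], then
    [2 c^2 - 1 = cosh (2 r)]. *)
Lemma cosh_dist_le (c : R) (p q : vec) : inH2R p -> inH2R q ->
  cosh_axis_dist p <= c -> cosh_axis_dist q <= c -> cosh_dist p q <= 2 * (c * c) - 1.
Proof.
  unfold inH2R. intros Hp Hq Cp Cq.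
  assert (P1 : 0 < cosh_axis_dist p) by (apply Rdiv_lt_0_compat; nra).
  assert (P2 : 0 < cosh_axis_dist q) by (apply Rdiv_lt_0_compat; nra).
  (* The hyperboloid model: [cosh_dist] is the Minkowski product. *)
  set (X1 := fun p => vx p / vy p). set (X2 := fun p => (vx p ^ 2 + vy p ^ 2 - 1) / (2 * vy p)).
  assert (Hyp : forall p, 0 < vy p ->
            cosh_axis_dist p * cosh_axis_dist p - X1 p * X1 p - X2 p * X2 p = 1).
  { intros s Hs. unfold cosh_axis_dist, X1, X2. field. lra. }
  assert (E : cosh_dist p q
              = cosh_axis_dist p * cosh_axis_dist q - X1 p * X1 q - X2 p * X2 q).
  { unfold cosh_dist, cosh_axis_dist, X1, X2. field. lra. }
  pose proof (Hyp p Hp). pose proof (Hyp q Hq). rewrite E.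
  pose proof (Rle_0_sqr (cosh_axis_dist p - cosh_axis_dist q)).
  pose proof (Rle_0_sqr (X1 p + X1 q)). pose proof (Rle_0_sqr (X2 p + X2 q)).
  unfold Rsqr in *. nra.
Qed.

(* A metric correspondence preserves vertical pairs, so it maps pairs of fibres missing [U] to pairs
   missing [V]; but two fibres missing [V] can be at distance [l + m], those missing [U] cannot.
   A relation rather than a map, so that the situation can be reversed. *)
Lemma no_metric_correspondence (l m : R) (U V : vec -> Prop) (Rel : vec -> vec -> Prop) :
  0 < l -> l < m ->
  (forall p, inH2R p -> exists q, inH2R q /\ Rel p q) ->
  (forall q, inH2R q -> exists p, inH2R p /\ Rel p q) ->
  (forall p q p' q', inH2R p -> inH2R q -> inH2R p' -> inH2R q' ->
     Rel p p' -> Rel q q' -> Defs.dist p q = Defs.dist p' q') ->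
  (forall p, U p -> inH2R p /\ exists q, V q /\ Rel p q) ->
  (forall p, inH2R p -> cosh l <= cosh_axis_dist p -> exists q, U q /\ vertical p q) ->
  (forall q, V q -> inH2R q /\ cosh m <= cosh_axis_dist q) -> False.
Proof.
  intros Hl Hlm tot surj iso UV covU boundV.
  (* Surjectivity allows the median identity of the image to be tested against every point. *)
  assert (vert : forall p q p' q', inH2R p -> inH2R q -> inH2R p' -> inH2R q' ->
            Rel p p' -> Rel q q' -> vertical p q -> vertical p' q').
  { intros p q p' q' Hp Hq Hp' Hq' Rp Rq Hpq.
    destruct (vertical_apollonius p q Hp Hpq) as (n & Hn & An).
    destruct (tot n Hn) as (n' & Hn' & Rn).
    apply (apollonius_vertical p' q' n' Hp' Hq' Hn').
    intros s' Hs'. destruct (surj s' Hs') as (s & Hs & Rs).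
    rewrite <- (iso s p s' p'), <- (iso s q s' q'), <- (iso s n s' n'), <- (iso p q p' q')
      by assumption.
    now apply An. }
  (* If [p] lay over the closed exterior of the disc of radius [l], its fibre would meet [U], and
     the fibre of [p'] would then meet [V]. *)
  assert (small : forall p', inH2R p' -> cosh_axis_dist p' < cosh m ->
            exists p, inH2R p /\ Rel p p' /\ cosh_axis_dist p <= cosh l).
  { intros p' Hp' Cp'. destruct (surj p' Hp') as (p & Hp & Rp). exists p. do 2 (split; trivial).
    apply Rnot_lt_le. intros Hlt.
    destruct (covU p Hp (Rlt_le _ _ Hlt)) as (s & Us & Ps).
    destruct (UV s Us) as (Hs & s' & Vs' & Rs).
    destruct (boundV s' Vs') as [Hs' Bs'].
    destruct (vert p s p' s') as [Ex Ey]; trivial.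
    unfold cosh_axis_dist in Cp', Bs'. rewrite Ex, Ey in Cp'. lra. }
  (* The points [p'] and [q'] chosen below lie over the two ends of a diameter, on the geodesic
     [x = 0], of the disc of radius [r] about [(0, 1)]. *)
  set (r := (l + m) / 2). assert (Hr : l < r < m) by (unfold r; lra).
  pose proof (exp_pos r) as He. pose proof (exp_pos (- r)) as He'.
  assert (Ee : exp r * exp (- r) = 1) by (rewrite <- exp_plus, Rplus_opp_r; apply exp_0).
  assert (Einv : exp (- r) = / exp r) by apply exp_Ropp.
  set (p' := (0, exp r, 0) : vec). set (q' := (0, exp (- r), 0) : vec).
  assert (Hp' : inH2R p') by exact He. assert (Hq' : inH2R q') by exact He'.
  assert (Cp' : cosh_axis_dist p' = cosh r).
  { unfold cosh_axis_dist, cosh, p', vx, vy; simpl. rewrite Einv. field. lra. }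
  assert (Cq' : cosh_axis_dist q' = cosh r).
  { unfold cosh_axis_dist, cosh, q', vx, vy; simpl. rewrite Einv. field. lra. }
  assert (Cpq' : cosh_dist p' q' = 2 * (cosh r * cosh r) - 1).
  { unfold cosh_dist, cosh, p', q', vx, vy; simpl. rewrite Einv. field. lra. }
  pose proof (cosh_increasing r m ltac:(lra) ltac:(lra)).
  pose proof (cosh_increasing l r ltac:(lra) ltac:(lra)).
  destruct (small p' Hp' ltac:(lra)) as (p & Hp & Rp & Cp).
  destruct (small q' Hq' ltac:(lra)) as (q & Hq & Rq & Cq).
  (* Sliding [q] along its fibre to the height of [p] makes the distance purely horizontal; the
     image of [q0] stays in the fibre of [q'], so its distance to [p'] is at least the horizontal
     distance of the two fibres. *)
  set (q0 := (vx q, vy q, vz p) : vec).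
  assert (Hq0 : inH2R q0) by exact Hq.
  destruct (tot q0 Hq0) as (q1 & Hq1 & Rq1).
  assert (V01 : vertical q' q1) by (apply (vert q q0); trivial; now split).
  pose proof (iso p q0 p' q1 Hp Hq0 Hp' Hq1 Rp Rq1) as E.
  assert (D1 : Defs.dist p q0 = distH2 p q).
  { unfold Defs.dist. rewrite (dist_vertical p q0 q) by now split.
    change (vz q0) with (vz p). replace (vz p - vz p) with 0 by ring.
    replace (distH2 p q ^ 2 + 0 ^ 2) with (distH2 p q ^ 2) by ring.
    apply sqrt_pow2. now apply distH2_nonneg. }
  assert (D2 : distH2 p' q' <= Defs.dist p' q1).
  { rewrite (dist_vertical p' q' q1 V01). unfold Defs.dist.
    rewrite <- (sqrt_pow2 (distH2 p' q1)) at 1 by now apply distH2_nonneg.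
    apply sqrt_le_1_alt. pose proof (pow2_ge_0 (vz p' - vz q1)). lra. }
  assert (D3 : distH2 p q < distH2 p' q').
  { apply (acosh_increasing (cosh_dist p q) (cosh_dist p' q')).
    - now apply cosh_dist_ge_1.
    - rewrite Cpq'. pose proof (cosh_dist_le (cosh l) p q Hp Hq Cp Cq).
      pose proof (cosh_pos l). nra. }
  lra.
Qed.

(** * The surface of revolution *)

Set Implicit Arguments.

(* With [r] the hyperbolic distance to the axis and [phi] the angle of the profile:
   [C = cosh r], [S = sinh r], [p = cos phi], [q = sin phi]. *)
Record profile_curve (l : R) (C S p q z : R -> R) : Prop := {
  pc_l_pos : 0 < l;
  pc_hyp : forall t, C t * C t - S t * S t = 1;
  pc_C_pos : forall t, 0 < C t;
  pc_S_ge : forall t, sinh l <= S t;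
  pc_circ : forall t, q t * q t + p t * p t = 1;
  pc_dC : forall t, is_derive C t (S t * p t);
  pc_dS : forall t, is_derive S t (C t * p t);
  pc_dp : forall t, is_derive p t (- q t * (2 * p t - C t * / S t * q t));
  pc_dq : forall t, is_derive q t (p t * (2 * p t - C t * / S t * q t));
  pc_dz : forall t, is_derive z t (q t);
  pc_pos : forall t, 0 < t -> 0 < p t;
  pc_neg : forall t, t < 0 -> p t < 0;
  pc_end_pos : exists T d, 0 < d /\ forall t, T <= t -> 1 / 4 <= p t /\ d <= q t;
  pc_end_neg : exists T d, 0 < d /\ forall t, t <= - T -> p t <= - (1 / 4) /\ q t <= - d;
  pc_neck : C 0 = cosh l;
  pc_C_ge : forall t, cosh l <= C t
}.

Unset Implicit Arguments.

Lemma cosh_le (x y : R) : 0 <= x -> x <= y -> cosh x <= cosh y.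
Proof. intros Hx [H|<-]; [left; now apply cosh_increasing | right; trivial]. Qed.

Lemma sinh_le (x y : R) : x <= y -> sinh x <= sinh y.
Proof. intros [H|<-]; [left; now apply sinh_increasing | right; trivial]. Qed.

(** In these functions the equations are polynomial apart from [1 / S], which turns the geometry of
    the surface into algebra. *)
Lemma profile_curve_exists (l : R) : 0 < l -> exists C S p q z, profile_curve l C S p q z.
Proof.
  intros Hl.
  destruct (profile_exists l Hl) as (phi & r & z & r0 & rl & dphi & dr & dz & pos & neg & Hp & Hn).
  exists (fun t => cosh (r t)), (fun t => sinh (r t)), (fun t => cos (phi t)),
    (fun t => sin (phi t)), z.
  assert (chain : forall (f df g : R -> R) t dg, (forall x, is_derive f x (df x)) ->
             is_derive g t dg -> is_derive (fun t => f (g t)) t (df (g t) * dg)).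
  { intros f df g t dg Hf Hg. rewrite Rmult_comm.
    apply (is_derive_comp f g t (df (g t)) dg); [apply Hf | exact Hg]. }
  split; trivial.
  - intros t. apply sq_cosh_sinh.
  - intros t. apply cosh_pos.
  - intros t. apply sinh_le, rl.
  - intros t. apply sq_sin_cos.
  - intros t. apply (chain cosh sinh); [apply is_derive_cosh | apply dr].
  - intros t. apply (chain sinh cosh); [apply is_derive_sinh | apply dr].
  - intros t. apply (chain cos (fun x => - sin x)); [|apply dphi].
    intros x. apply is_derive_Reals, derivable_pt_lim_cos.
  - intros t. apply (chain sin cos); [|apply dphi].
    intros x. apply is_derive_Reals, derivable_pt_lim_sin.
  - now rewrite r0.
  - intros t. apply cosh_le; [lra | apply rl].
Qed.

(* The point at distance [r] from [i] in the upper half-plane, in the direction making angle [th]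
   with the upward vertical, has [1/y = cosh r - sinh r cos th] and [x/y = sinh r sin th]. *)
Definition rot_y (C S : R -> R) (th t : R) : R := / (C t - S t * cos th).
Definition rot_x (C S : R -> R) (th t : R) : R := S t * sin th * rot_y C S th t.
Definition rot_surf (C S z : R -> R) : surf :=
  fun th t => (rot_x C S th t, rot_y C S th t, z t).
(** The profile tangent turned by a quarter: [- q] times the unit radial vector plus [p] times the
    vertical one. *)
Definition rot_normal (C S p q : R -> R) : surf := fun th t =>
  (- (q t * (rot_y C S th t * rot_y C S th t) * sin th),
   - (q t * (rot_y C S th t * rot_y C S th t) * (C t * cos th - S t)),
   p t).

Section RotationSurface.

Context (l : R) (C S p q z : R -> R) (Hpc : profile_curve l C S p q z).

Notation y := (rot_y C S).
Notation x := (rot_x C S).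
Notation F := (rot_surf C S z).
Notation eta := (rot_normal C S p q).
Notation A := (fun th t => C t * cos th - S t).
Notation k := (fun t => 2 * p t - C t * / S t * q t).

Lemma S_pos (t : R) : 0 < S t.
Proof. pose proof (pc_S_ge Hpc t). pose proof (sinh_pos l (pc_l_pos Hpc)). lra. Qed.

Lemma denom_pos (th t : R) : 0 < C t - S t * cos th.
Proof.
  pose proof (S_pos t). pose proof (pc_hyp Hpc t). pose proof (pc_C_pos Hpc t).
  pose proof (COS_bound th). assert (S t < C t) by nra. nra.
Qed.

Lemma rot_y_pos (th t : R) : 0 < y th t.
Proof. apply Rinv_0_lt_compat, denom_pos. Qed.

Lemma rot_y_eq (th t : R) : y th t * (C t - S t * cos th) = 1.
Proof. apply Rinv_l. pose proof (denom_pos th t). lra. Qed.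

(** Bootstrap: the derivatives are polynomials in the four functions and [1 / S], so regularity of
    order [n] yields order [n + 1]. *)
Lemma smooth_profile (n : nat) :
  smooth n (fun _ t => C t) /\ smooth n (fun _ t => S t) /\
  smooth n (fun _ t => p t) /\ smooth n (fun _ t => q t).
Proof.
  induction n as [|n (IC & IS & Ip & Iq)].
  - repeat split; apply cont2_of_snd; intros t;
      [ apply (ex_derive_continuous C) | apply (ex_derive_continuous S)
      | apply (ex_derive_continuous p) | apply (ex_derive_continuous q)];
      eexists; [apply (pc_dC Hpc) | apply (pc_dS Hpc) | apply (pc_dp Hpc) | apply (pc_dq Hpc)].
  - assert (Ik : smooth n (fun _ t => k t)).
    { apply smooth_minus; repeat apply smooth_mult; trivial; try apply smooth_const.
      apply (smooth_inv n (fun _ t => S t)); trivial. intros _ t. pose proof (S_pos t). lra. }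
    split; [|split; [|split]].
    + apply (smooth_of_snd n _ _ (pc_dC Hpc)). now apply smooth_mult.
    + apply (smooth_of_snd n _ _ (pc_dS Hpc)). now apply smooth_mult.
    + apply (smooth_of_snd n _ _ (pc_dp Hpc)).
      apply (smooth_mult n (fun _ t => - q t) (fun _ t => k t)); trivial. now apply smooth_opp.
    + apply (smooth_of_snd n _ _ (pc_dq Hpc)).
      now apply (smooth_mult n (fun _ t => p t) (fun _ t => k t)).
Qed.

Lemma smooth_rot_y (n : nat) : smooth n y.
Proof.
  destruct (smooth_profile n) as (IC & IS & _). destruct (smooth_sin_cos n) as [_ Ic].
  apply (smooth_inv n (fun th t => C t - S t * cos th)).
  - intros th t. pose proof (denom_pos th t). lra.
  - apply smooth_minus; [exact IC|].
    now apply (smooth_mult n (fun _ t => S t) (fun th _ => cos th)).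
Qed.

Lemma smooth_rot_surf (i n : nat) : smooth n (comp F i).
Proof.
  destruct (smooth_profile n) as (IC & IS & _ & Iq). destruct (smooth_sin_cos n) as [Is _].
  destruct i as [|[|i]].
  - apply (smooth_mult n (fun th t => S t * sin th) y); [|apply smooth_rot_y].
    now apply (smooth_mult n (fun _ t => S t) (fun th _ => sin th)).
  - apply smooth_rot_y.
  - apply smooth_pred. now apply (smooth_of_snd n z q (pc_dz Hpc)).
Qed.

Lemma smooth_rot_normal (i n : nat) : smooth n (comp eta i).
Proof.
  destruct (smooth_profile n) as (IC & IS & Ip & Iq). destruct (smooth_sin_cos n) as [Is Ic].
  pose proof (smooth_rot_y n) as Iy.
  assert (Iqy : smooth n (fun th t => q t * (y th t * y th t))).
  { apply (smooth_mult n (fun _ t => q t) (fun th t => y th t * y th t)); trivial.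
    now apply smooth_mult. }
  destruct i as [|[|i]].
  - apply smooth_opp.
    now apply (smooth_mult n (fun th t => q t * (y th t * y th t)) (fun th _ => sin th)).
  - apply smooth_opp.
    apply (smooth_mult n (fun th t => q t * (y th t * y th t)) A); trivial.
    apply (smooth_minus n (fun th t => C t * cos th) (fun _ t => S t)); trivial.
    now apply (smooth_mult n (fun _ t => C t) (fun th _ => cos th)).
  - exact Ip.
Qed.

Ltac ex_derive_hyp := eexists; match goal with H : is_derive _ _ _ |- _ => exact H end.

Ltac clear_nsatz := repeat match goal with H : is_derive _ _ _ |- _ => clear H end; nsatz.

Ltac simpl_Derive :=
  repeat match goal with
  | H : is_derive ?f ?a ?v |- context [Derive ?g ?a] =>
      replace (Derive g a) with v by (symmetry; apply (is_derive_unique f), H)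
  end.

(** * Partial derivatives of the parametrization *)

Lemma is_derive_y_th (th t : R) :
  is_derive (fun s => y s t) th (- (S t * sin th * (y th t * y th t))).
Proof.
  pose proof (denom_pos th t). unfold rot_y. auto_derive; [lra|]. field. lra.
Qed.

Lemma is_derive_y_t (th t : R) : is_derive (fun s => y th s) t (y th t * y th t * A th t * p t).
Proof.
  pose proof (denom_pos th t). unfold rot_y.
  pose proof (pc_dC Hpc t) as dC. pose proof (pc_dS Hpc t) as dS.
  auto_derive.
  - repeat split; try ex_derive_hyp. lra.
  - simpl_Derive. field. lra.
Qed.

Lemma is_derive_x_th (th t : R) : is_derive (fun s => x s t) th (S t * (y th t * y th t) * A th t).
Proof.
  pose proof (is_derive_y_th th t) as dy. pose proof (rot_y_eq th t) as Hy.
  (* With [y] as an unknown function of known derivative, the claim becomes a polynomial identity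
     modulo [y (C - S cos th) = 1] and [sin^2 + cos^2 = 1]. *)
  unfold rot_x. set (Y := fun s => y s t) in *.
  apply (is_derive_ext (fun s => S t * sin s * Y s)); [reflexivity|].
  auto_derive; [repeat split; ex_derive_hyp|]. simpl_Derive. subst Y; cbv beta in *.
  pose proof (sq_sin_cos th). clear_nsatz.
Qed.

Lemma is_derive_x_t (th t : R) : is_derive (fun s => x th s) t (y th t * y th t * sin th * p t).
Proof.
  pose proof (is_derive_y_t th t) as dy. pose proof (rot_y_eq th t) as Hy.
  pose proof (pc_dS Hpc t) as dS. pose proof (pc_hyp Hpc t).
  unfold rot_x. set (Y := fun s => y th s) in *.
  apply (is_derive_ext (fun s => S s * sin th * Y s)); [reflexivity|].
  auto_derive; [repeat split; ex_derive_hyp|]. simpl_Derive. subst Y; cbv beta in *.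
  clear_nsatz.
Qed.

Lemma is_derive_x_th_th (th t : R) :
  is_derive (fun s => S t * (y s t * y s t) * A s t) th
    (- 2 * (S t * S t) * sin th * A th t * (y th t * y th t * y th t)
     - S t * C t * sin th * (y th t * y th t)).
Proof.
  pose proof (is_derive_y_th th t) as dy. set (Y := fun s => y s t) in *.
  apply (is_derive_ext (fun s => S t * (Y s * Y s) * (C t * cos s - S t))); [reflexivity|].
  auto_derive; [repeat split; ex_derive_hyp|]. simpl_Derive. subst Y; cbv beta in *. ring.
Qed.

Lemma is_derive_y_th_th (th t : R) :
  is_derive (fun s => - (S t * sin s * (y s t * y s t))) th
    (- S t * cos th * (y th t * y th t)
     + 2 * (S t * S t) * (sin th * sin th) * (y th t * y th t * y th t)).
Proof.
  pose proof (is_derive_y_th th t) as dy. set (Y := fun s => y s t) in *.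
  apply (is_derive_ext (fun s => - (S t * sin s * (Y s * Y s)))); [reflexivity|].
  auto_derive; [repeat split; ex_derive_hyp|]. simpl_Derive. subst Y; cbv beta in *. ring.
Qed.

Lemma is_derive_x_t_t (th t : R) :
  is_derive (fun s => y th s * y th s * sin th * p s) t
    (2 * (y th t * y th t * y th t) * A th t * sin th * (p t * p t)
     - y th t * y th t * sin th * (q t * k t)).
Proof.
  pose proof (is_derive_y_t th t) as dy. pose proof (pc_dp Hpc t) as dp.
  set (Y := fun s => y th s) in *.
  apply (is_derive_ext (fun s => Y s * Y s * sin th * p s)); [reflexivity|].
  auto_derive; [repeat split; ex_derive_hyp|]. simpl_Derive. subst Y; cbv beta in *. ring.
Qed.

Lemma is_derive_y_t_t (th t : R) :
  is_derive (fun s => y th s * y th s * A th s * p s) t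
    (2 * (y th t * y th t * y th t) * (A th t * A th t) * (p t * p t) - y th t * (p t * p t)
     - y th t * y th t * A th t * (q t * k t)).
Proof.
  pose proof (is_derive_y_t th t) as dy. pose proof (pc_dp Hpc t) as dp.
  pose proof (pc_dC Hpc t) as dC. pose proof (pc_dS Hpc t) as dS.
  pose proof (rot_y_eq th t) as Hy.
  set (Y := fun s => y th s) in *.
  apply (is_derive_ext (fun s => Y s * Y s * (C s * cos th - S s) * p s)); [reflexivity|].
  auto_derive; [repeat split; ex_derive_hyp|]. simpl_Derive. subst Y; cbv beta in *.
  set (K := k t). change (2 * p t - C t * / S t * q t) with K. clear_nsatz.
Qed.

(** * Fundamental forms and the soliton equation *)

Lemma F1_eq (th t : R) :
  F1 F th t = (S t * (y th t * y th t) * A th t, - (S t * sin th * (y th t * y th t)), 0).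
Proof.
  unfold F1, mkv. f_equal; [f_equal|]; unfold Defs.d1.
  - apply is_derive_unique, is_derive_x_th.
  - apply is_derive_unique, is_derive_y_th.
  - exact (Derive_const (z t) th).
Qed.

Lemma F2_eq (th t : R) :
  F2 F th t = (y th t * y th t * sin th * p t, y th t * y th t * A th t * p t, q t).
Proof.
  unfold F2, mkv. f_equal; [f_equal|]; unfold Defs.d2.
  - apply is_derive_unique, is_derive_x_t.
  - apply is_derive_unique, is_derive_y_t.
  - apply is_derive_unique, (pc_dz Hpc).
Qed.

Lemma F11_eq (th t : R) : F11 F th t =
  (- 2 * (S t * S t) * sin th * A th t * (y th t * y th t * y th t)
     - S t * C t * sin th * (y th t * y th t),
   - S t * cos th * (y th t * y th t)
     + 2 * (S t * S t) * (sin th * sin th) * (y th t * y th t * y th t), 0).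
Proof.
  unfold F11, mkv. f_equal; [f_equal|]; unfold Defs.d1 at 1.
  - apply is_derive_unique. refine (is_derive_ext _ _ _ _ _ (is_derive_x_th_th th t)).
    intros s. symmetry. apply is_derive_unique, is_derive_x_th.
  - apply is_derive_unique. refine (is_derive_ext _ _ _ _ _ (is_derive_y_th_th th t)).
    intros s. symmetry. apply is_derive_unique, is_derive_y_th.
  - apply is_derive_unique. refine (is_derive_ext (fun _ => 0) _ _ _ _ _).
    + intros s. symmetry. exact (Derive_const (z t) s).
    + apply @is_derive_const.
Qed.

Lemma F22_eq (th t : R) : F22 F th t =
  (2 * (y th t * y th t * y th t) * A th t * sin th * (p t * p t)
     - y th t * y th t * sin th * (q t * k t),
   2 * (y th t * y th t * y th t) * (A th t * A th t) * (p t * p t) - y th t * (p t * p t)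
     - y th t * y th t * A th t * (q t * k t), p t * k t).
Proof.
  unfold F22, mkv. f_equal; [f_equal|]; unfold Defs.d2 at 1.
  - apply is_derive_unique. refine (is_derive_ext _ _ _ _ _ (is_derive_x_t_t th t)).
    intros s. symmetry. apply is_derive_unique, is_derive_x_t.
  - apply is_derive_unique. refine (is_derive_ext _ _ _ _ _ (is_derive_y_t_t th t)).
    intros s. symmetry. apply is_derive_unique, is_derive_y_t.
  - apply is_derive_unique. refine (is_derive_ext q _ _ _ _ (pc_dq Hpc t)).
    intros s. symmetry. apply is_derive_unique, (pc_dz Hpc).
Qed.

(* [y^2 (sin th, C cos th - S)] is the unit radial vector of the hyperbolic plane. *)
Lemma radial_norm (th t : R) :
  y th t * y th t * (sin th * sin th + A th t * A th t) = 1.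
Proof.
  pose proof (rot_y_eq th t). pose proof (sq_sin_cos th). pose proof (pc_hyp Hpc t).
  cbv beta. clear_nsatz.
Qed.

Lemma fE_eq (th t : R) : fE F th t = S t * S t.
Proof.
  unfold fE, gm. rewrite F1_eq. unfold vx, vy, vz, rot_surf; simpl.
  pose proof (rot_y_pos th t). pose proof (radial_norm th t) as E. cbv beta in E.
  transitivity (S t * S t * (y th t * y th t * (sin th * sin th + (C t * cos th - S t) * (C t * cos th - S t)))).
  - field. lra.
  - rewrite E. ring.
Qed.

Lemma fF_eq (th t : R) : fF F th t = 0.
Proof.
  unfold fF, gm. rewrite F1_eq, F2_eq. unfold vx, vy, vz, rot_surf; simpl.
  pose proof (rot_y_pos th t). field. lra.
Qed.

Lemma fG_eq (th t : R) : fG F th t = 1.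
Proof.
  unfold fG, gm. rewrite F2_eq. unfold vx, vy, vz, rot_surf; simpl.
  pose proof (rot_y_pos th t). pose proof (radial_norm th t) as E. cbv beta in E.
  transitivity (p t * p t * (y th t * y th t * (sin th * sin th + (C t * cos th - S t) * (C t * cos th - S t)))
    + q t * q t).
  - field. lra.
  - rewrite E. pose proof (pc_circ Hpc t). lra.
Qed.

Lemma normal_F1 (th t : R) : gm (F th t) (eta th t) (F1 F th t) = 0.
Proof.
  unfold gm. rewrite F1_eq. unfold vx, vy, vz, rot_surf, rot_normal; simpl.
  pose proof (rot_y_pos th t). field. lra.
Qed.

Lemma normal_F2 (th t : R) : gm (F th t) (eta th t) (F2 F th t) = 0.
Proof.
  unfold gm. rewrite F2_eq. unfold vx, vy, vz, rot_surf, rot_normal; simpl.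
  pose proof (rot_y_pos th t). pose proof (radial_norm th t) as E. cbv beta in E.
  transitivity (p t * q t * (1 - y th t * y th t
     * (sin th * sin th + (C t * cos th - S t) * (C t * cos th - S t)))).
  - field. lra.
  - rewrite E. ring.
Qed.

Lemma normal_unit (th t : R) : gm (F th t) (eta th t) (eta th t) = 1.
Proof.
  unfold gm. unfold vx, vy, vz, rot_surf, rot_normal; simpl.
  pose proof (rot_y_pos th t). pose proof (radial_norm th t) as E. cbv beta in E.
  transitivity (q t * q t * (y th t * y th t * (sin th * sin th + (C t * cos th - S t) * (C t * cos th - S t)))
    + p t * p t).
  - field. lra.
  - rewrite E. pose proof (pc_circ Hpc t). lra.
Qed.

(** The value is [phi']: the profile lies in a totally geodesic vertical plane, so its normal
    curvature is its plane curvature. *)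
Lemma fN_eq (th t : R) : fN F eta th t = k t.
Proof.
  unfold fN, gm, christ, vadd. rewrite F22_eq, F2_eq.
  unfold vx, vy, vz, rot_surf, rot_normal; simpl.
  pose proof (rot_y_pos th t). pose proof (radial_norm th t) as E. cbv beta in E.
  set (K := 2 * p t - C t * / S t * q t).
  set (Y := y th t) in *. set (a := C t * cos th - S t) in *. clearbody K Y a.
  (* The first bracket is the squared norm of the normal; the second term vanishes because the
     radial vector is unit, which reflects that radial rays are geodesics. *)
  transitivity (K * (q t * q t * (Y * Y * (sin th * sin th + a * a)) + p t * p t)
    + p t * p t * q t * a * Y * (1 - Y * Y * (sin th * sin th + a * a))).
  - field. lra.
  - rewrite E, Rmult_1_r, (pc_circ Hpc t). ring.
Qed.

(** Divided by [S^2] this is [coth r sin phi]: the geodesic curvature [coth r] of a hyperbolic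
    circle, projected on the normal. *)
Lemma fL_eq (th t : R) : fL F eta th t = S t * C t * q t.
Proof.
  unfold fL, gm, christ, vadd. rewrite F11_eq, F1_eq.
  unfold vx, vy, vz, rot_surf, rot_normal; simpl.
  pose proof (rot_y_pos th t). pose proof (radial_norm th t) as E. cbv beta in E.
  pose proof (rot_y_eq th t). pose proof (sq_sin_cos th). pose proof (pc_hyp Hpc t).
  remember (y th t) as Y eqn:EY. remember (C t * cos th - S t) as a eqn:Ea.
  transitivity (q t * S t * (C t * (sin th * sin th) * (Y * Y) + a * cos th * (Y * Y)
    - S t * a * Y * (Y * Y * (sin th * sin th + a * a)))).
  - field. lra.
  - rewrite E. clear EY E. clear_nsatz.
Qed.

(** The coordinates are orthogonal, so the mean curvature is half of [phi' + coth r sin phi]; the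
    angle equation makes it [cos phi], the vertical component of the normal. *)
Lemma meanH_eq (th t : R) : meanH F eta th t = gm (F th t) (eta th t) (mkv 0 0 1).
Proof.
  unfold meanH. rewrite fE_eq, fF_eq, fG_eq, fN_eq, fL_eq.
  unfold gm, vx, vy, vz, rot_surf, rot_normal, mkv; simpl.
  pose proof (rot_y_pos th t). pose proof (S_pos t). field. split; lra.
Qed.

(** * Projection of the surface to the hyperbolic plane *)

Lemma cosh_axis_dist_rot (th t : R) : cosh_axis_dist (rot_surf C S z th t) = C t.
Proof.
  unfold cosh_axis_dist. change (vx (rot_surf C S z th t)) with (rot_x C S th t).
  change (vy (rot_surf C S z th t)) with (rot_y C S th t). unfold rot_x.
  pose proof (rot_y_pos th t). pose proof (rot_y_eq th t).
  pose proof (pc_hyp Hpc t). pose proof (sq_sin_cos th).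
  apply Rmult_eq_reg_r with (2 * rot_y C S th t); [|lra].
  unfold Rdiv. rewrite Rmult_assoc, Rinv_l, Rmult_1_r by lra.
  set (y := rot_y C S th t) in *.
  transitivity ((S t * S t) * (y * y) * (sin th * sin th + cos th * cos th)
    - (y * (S t * cos th)) * (y * (S t * cos th)) + y * y + 1); [ring|].
  replace (y * (S t * cos th)) with (y * C t - 1) by lra.
  replace (S t * S t) with (C t * C t - 1) by lra. rewrite sq_sin_cos. ring.
Qed.

(** The projected point determines its distance to the axis; at a given [t], since [S > 0], its
    coordinates also determine [cos th] and [sin th]. *)
Lemma rot_surf_fibre (th1 t1 th2 t2 : R) :
  vx (rot_surf C S z th1 t1) = vx (rot_surf C S z th2 t2) ->
  vy (rot_surf C S z th1 t1) = vy (rot_surf C S z th2 t2) ->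
  C t1 = C t2 /\ (t1 = t2 -> exists k : Z, th2 = th1 + 2 * PI * IZR k).
Proof.
  intros Ex Ey. split.
  - rewrite <- (cosh_axis_dist_rot th1 t1), <- (cosh_axis_dist_rot th2 t2).
    unfold cosh_axis_dist. now rewrite Ex, Ey.
  - intros <-. pose proof (S_pos t1) as HS.
    change (rot_x C S th1 t1 = rot_x C S th2 t1) in Ex.
    change (rot_y C S th1 t1 = rot_y C S th2 t1) in Ey.
    unfold rot_x in Ex. rewrite <- Ey in Ex.
    pose proof (rot_y_eq th1 t1) as E1.
    pose proof (rot_y_eq th2 t1) as E2. rewrite <- Ey in E2.
    pose proof (rot_y_pos th1 t1) as Hy.
    apply angle_unique.
    + apply Rmult_eq_reg_l with (rot_y C S th1 t1 * S t1); nra.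
    + apply Rmult_eq_reg_l with (rot_y C S th1 t1 * S t1); nra.
Qed.

(** [C] starts from [cosh l] at the neck and grows at least linearly, so some circle of the surface
    has the required radius. *)
Lemma rot_surf_covers (u : vec) : inH2R u -> cosh l <= cosh_axis_dist u ->
  exists th t, vertical u (rot_surf C S z th t).
Proof.
  unfold inH2R. intros Hu Hl.
  destruct (pc_end_pos Hpc) as (T & d & Hd & HT).
  assert (Hm : 0 < sinh l) by apply sinh_pos, (pc_l_pos Hpc).
  destruct (linear_growth C (fun t => S t * p t) T (sinh l * (1 / 4)) ltac:(lra)
              (pc_dC Hpc)) with (B := cosh_axis_dist u) as [T' HT'].
  { intros t Ht. pose proof (pc_S_ge Hpc t). destruct (HT t Ht).
    apply Rmult_le_compat; lra. }
  specialize (HT' (T' + 1) ltac:(lra)).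
  destruct (IVT_gen C 0 (T' + 1) (cosh_axis_dist u)) as (t & _ & Et).
  - intros s. apply continuity_pt_filterlim, (ex_derive_continuous C s).
    eexists; apply (pc_dC Hpc).
  - rewrite (pc_neck Hpc). rewrite Rmin_left, Rmax_right by lra. lra.
  - pose proof (S_pos t) as HS. pose proof (pc_hyp Hpc t) as Hh.
    assert (Eu : 2 * vy u * C t = vx u * vx u + vy u * vy u + 1).
    { rewrite Et. unfold cosh_axis_dist. field. lra. }
    (* These values solve [1/y = C - S cos th] and [x/y = S sin th]; they lie on the unit circle
       because [C t = cosh_axis_dist u]. *)
    destruct (angle_exists ((C t - / vy u) / S t) (vx u / vy u / S t)) as (th & Ec & Es).
    { apply Rmult_eq_reg_r with (S t * S t * (vy u * vy u));
        [|apply Rgt_not_eq; repeat apply Rmult_lt_0_compat; lra].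
      transitivity ((C t * vy u - 1) * (C t * vy u - 1) + vx u * vx u); [field; lra|].
      replace (S t * S t) with (C t * C t - 1) by lra. lra. }
    exists th, t.
    assert (Ey : rot_y C S th t = vy u).
    { unfold rot_y. rewrite Ec. field_simplify; [reflexivity|lra..]. }
    split; [|symmetry; exact Ey].
    change (vx u = rot_x C S th t). unfold rot_x. rewrite Ey, Es. field. lra.
Qed.

Lemma rot_annular : annular_translator (rot_surf C S z) (rot_normal C S p q).
Proof.
  destruct (pc_end_pos Hpc) as (T1 & e1 & He1 & HT1).
  destruct (pc_end_neg Hpc) as (T2 & e2 & He2 & HT2).
  assert (up : forall B, exists T, forall t, T < t -> B < z t).
  { apply (linear_growth z q T1 e1 He1); [apply (pc_dz Hpc) | apply HT1]. }
  assert (down : forall B, exists T, forall t, t < - T -> B < z t).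
  { intros B.
    destruct (linear_growth (fun t => z (- t)) (fun t => - q (- t)) T2 e2 He2) with (B := B) as [T HT].
    - intros t. apply (is_derive_reverse z), (pc_dz Hpc).
    - intros t Ht. destruct (HT2 (- t)); lra.
    - exists T. intros t Ht. specialize (HT (- t) ltac:(lra)). now rewrite Ropp_involutive in HT. }
  assert (inj_up : forall s t, 0 < s -> s < t -> C s < C t).
  { intros s t Hs Hst. apply (derive_pos_lt C _ _ _ Hst (pc_dC Hpc)).
    intros v Hv. apply Rmult_lt_0_compat;
      [apply S_pos | apply (pc_pos Hpc); lra]. }
  assert (inj_down : forall s t, t < 0 -> s < t -> C t < C s).
  { intros s t Ht Hst. apply Ropp_lt_cancel.
    apply (derive_pos_lt (fun t => - C t) (fun t => - (S t * p t)) _ _ Hst).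
    - intros v. apply @is_derive_opp, (pc_dC Hpc).
    - intros v Hv. pose proof (S_pos v).
      assert (p v < 0) by (apply (pc_neg Hpc); lra). nra. }
  unfold annular_translator.
  split; [intros i; apply smooth_C2, smooth_rot_surf|].
  split; [intros th t; apply rot_y_pos|].
  assert (per : forall th, cos (th + 2 * PI) = cos th /\ sin (th + 2 * PI) = sin th).
  { intros th. rewrite cos_plus, sin_plus, cos_2PI, sin_2PI. split; ring. }
  split; [intros th t; unfold rot_surf, rot_x, rot_y; destruct (per th) as [-> ->]; reflexivity|].
  split.
  { intros th t. rewrite fE_eq, fF_eq, fG_eq.
    pose proof (S_pos t). nra. }
  split; [intros i; apply (smooth_cont2 0), smooth_rot_normal|].
  split; [intros th t; unfold rot_normal, rot_y; destruct (per th) as [-> ->]; reflexivity|].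
  split.
  { intros th t. split; [|split].
    - apply normal_F1.
    - apply normal_F2.
    - apply normal_unit. }
  split; [intros th t; apply meanH_eq|].
  split.
  (* Properness: a bound on the height alone already bounds [t]. *)
  { intros K (_ & (B & HB) & _). destruct (up B) as [T3 H3]. destruct (down B) as [T4 H4].
    exists (Rmax T3 T4). intros th t Kt. destruct (HB _ Kt) as (_ & _ & Hz).
    change (Rabs (z t) <= B) in Hz. pose proof (Rle_abs (z t)).
    pose proof (Rmax_l T3 T4). pose proof (Rmax_r T3 T4).
    apply Rabs_le. split; apply Rnot_lt_le; intros Hlt.
    - specialize (H4 t ltac:(lra)). lra.
    - specialize (H3 t ltac:(lra)). lra. }
  split; [intros B; destruct (up B) as [T HT]; exists T; intros th t; apply HT|].
  split; [intros B; destruct (down B) as [T HT]; exists T; intros th t; apply HT|].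
  (* Each open half beyond the neck is already a graph: [C] is strictly monotone on it and [p] has
     constant sign. *)
  split; exists 0; split.
  - intros th1 t1 th2 t2 H1 H2 Ex Ey. destruct (rot_surf_fibre _ _ _ _ Ex Ey) as [EC Eth].
    assert (t1 = t2); [|now auto].
    destruct (Rtotal_order t1 t2) as [H|[H|H]]; trivial.
    + pose proof (inj_up _ _ H1 H). lra.
    + pose proof (inj_up _ _ H2 H). lra.
  - intros th t Ht. apply Rgt_not_eq, (pc_pos Hpc), Ht.
  - intros th1 t1 th2 t2 H1 H2 Ex Ey. destruct (rot_surf_fibre _ _ _ _ Ex Ey) as [EC Eth].
    assert (t1 = t2); [|now auto].
    destruct (Rtotal_order t1 t2) as [H|[H|H]]; trivial.
    + pose proof (inj_down t1 t2 ltac:(lra) H). lra.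
    + pose proof (inj_down t2 t1 ltac:(lra) H). lra.
  - intros th t Ht. apply Rlt_not_eq, (pc_neg Hpc). lra.
Qed.

End RotationSurface.

(** * The family, parametrized by its neck radius *)

Theorem theorem3p4 :
  exists (a b : R) (F : R -> surf) (eta : R -> surf),
    a < b /\
    (forall lam, a < lam < b -> annular_translator (F lam) (eta lam)) /\
    (forall lam mu, a < lam < b -> a < mu < b -> lam <> mu ->
       ~ congruent (F lam) (F mu)).
Proof.
  (* The last two clauses say that the fibres meeting the surface are exactly those outside the open
     disc of radius [l]. The property is vacuous for [l <= 0], so that a surface, there a constant
     default, can be chosen for every real [l]. *)
  pose (good := fun (l : R) (Fe : surf * surf) => 0 < l ->
    annular_translator (fst Fe) (snd Fe) /\
    (forall th t, cosh l <= cosh_axis_dist (fst Fe th t)) /\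
    (forall u, inH2R u -> cosh l <= cosh_axis_dist u ->
       exists th t, vertical u (fst Fe th t))).
  assert (Hex : forall l, exists Fe, good l Fe).
  { intros l. destruct (Rlt_dec 0 l) as [Hl|Hl].
    - destruct (profile_curve_exists l Hl) as (C & S & p & q & z & Hpc).
      exists (rot_surf C S z, rot_normal C S p q). intros _. split; [|split].
      + apply (rot_annular _ _ _ _ _ _ Hpc).
      + intros th t. unfold fst. rewrite (cosh_axis_dist_rot _ _ _ _ _ _ Hpc).
        apply (pc_C_ge Hpc).
      + apply (rot_surf_covers _ _ _ _ _ _ Hpc).
    - exists ((fun _ _ => (0, 0, 0)), (fun _ _ => (0, 0, 0))). intros H; contradiction. }
  pose (Fe := fun l => proj1_sig (constructive_indefinite_description _ (Hex l))).
  assert (HFe : forall l, good l (Fe l)).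
  { intros l. apply (proj2_sig (constructive_indefinite_description _ (Hex l))). }
  exists 0, 1, (fun l => fst (Fe l)), (fun l => snd (Fe l)).
  split; [lra|]. split; [intros l Hl; apply (HFe l); lra|].
  intros l m Hl Hm Hne (Phi & (Pin & Psurj & Piso) & Pimg).
  destruct (HFe l ltac:(lra)) as ((_ & inl & _) & bl & cl).
  destruct (HFe m ltac:(lra)) as ((_ & inm & _) & bm & cm).
  set (U := fun p => exists th t, fst (Fe l) th t = p).
  set (V := fun p => exists th t, fst (Fe m) th t = p).
  destruct (Rtotal_order l m) as [H|[H|H]]; [|contradiction|].
  - apply (no_metric_correspondence l m U V (fun p q => Phi p = q)); try lra.
    + intros p Hp. exists (Phi p). auto.
    + intros q Hq. apply Psurj, Hq.
    + intros p q p' q' Hp Hq _ _ <- <-. symmetry. now apply Piso.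
    + intros p (th & t & <-). split; [apply inl|]. eexists; split; [|reflexivity].
      apply Pimg. now exists th, t.
    + intros p Hp Cp. destruct (cl p Hp Cp) as (th & t & Hv).
      eexists; split; [now exists th, t | exact Hv].
    + intros p (th & t & <-). split; [apply inm | apply bm].
  (* For [m < l] the graph of [Phi] is read backwards, without constructing an inverse. *)
  - apply (no_metric_correspondence m l V U (fun p q => Phi q = p)); try lra.
    + intros q Hq. apply Psurj, Hq.
    + intros p Hp. exists (Phi p). auto.
    + intros p q p' q' _ _ Hp Hq <- <-. now apply Piso.
    + intros p Vp. destruct (proj2 (Pimg p) Vp) as (th & t & E). split.
      * destruct Vp as (th' & t' & <-). apply inm.
      * exists (fst (Fe l) th t). split; [now exists th, t | exact E].
    + intros p Hp Cp. destruct (cm p Hp Cp) as (th & t & Hv).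
      eexists; split; [now exists th, t | exact Hv].
    + intros p (th & t & <-). split; [apply inl | apply bl].
Qed.
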